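(* Let $\alpha\in[0,1)$ and $\beta=1-\alpha$. Let $\Psi_1,\Psi_2:\mathbb{R}^N\to\mathbb{R}$ and $F:\Gamma\to\mathbb{R}$ be bounded Borel functions such that $\Psi_1\le\Psi_2$ in $X$ and $\Psi_1\le F\le\Psi_2$ in $\Gamma$. Let $0<\epsilon<\bar\epsilon_0$ and let $u_\epsilon:X\to\mathbb{R}$ be the unique Borel function satisfying $$u_\epsilon(x)=\begin{cases}\max\Big\{\Psi_1(x),\ \min\Big\{\Psi_2(x),\ \dfrac{\alpha}{2}\sup_{B_\epsilon(x)}u_\epsilon+\dfrac{\alpha}{2}\inf_{B_\epsilon(x)}u_\epsilon+\dfrac{\beta}{|B_\epsilon(x)|}\displaystyle\int_{B_\epsilon(x)}u_\epsilon\Big\}\Big\} & \text{for } x\in\Omega,\\[2mm] F(x) & \text{for } x\in\Gamma.\end{cases}$$ Let $u_I,u_{II}$ be the value functions of the tug-of-war game with double stopping times: $$u_I(x_0)=\sup_{\sigma_I,\tau_I}\ \inf_{\sigma_{II},\tau_{II}}\mathbb{E}^{x_0}_{\sigma_I,\sigma_{II},\tau_I\wedge\tau_{II}}\big[G^{\tau_I,\tau_{II}}_{\tau_I\wedge\tau_{II}}\big],\qquad u_{II}(x_0)=\inf_{\sigma_{II},\tau_{II}}\ \sup_{\sigma_I,\tau_I}\mathbb{E}^{x_0}_{\sigma_I,\sigma_{II},\tau_I\wedge\tau_{II}}\big[G^{\tau_I,\tau_{II}}_{\tau_I\wedge\tau_{II}}\big].$$ Then $u_I=u_{II}=u_\epsilon$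 in $\Omega$.
   Context: $\Omega\subset\mathbb{R}^N$ is an open, bounded domain with Lipschitz boundary. $\bar\epsilon_0$ with $0<\bar\epsilon_0\ll1$ is a fixed small constant, $\Gamma=\{x\in\mathbb{R}^N\setminus\Omega:\ \mathrm{dist}(x,\Omega)<\bar\epsilon_0\}$ and $X=\Gamma\cup\Omega$. $B_\epsilon(x)$ is the open ball of radius $\epsilon$ centered at $x$, and $|B_\epsilon(x)|$ its Lebesgue measure. It is known that the displayed equation for $u_\epsilon$ has exactly one Borel solution. Path space. For $x_0\in X$ let $X^{\infty,x_0}=\{\omega=(x_0,x_1,x_2,\ldots): x_n\in X \text{ for all } n\ge1\}$. For $n\ge1$, $\mathcal{F}_n^{x_0}$ is the $\sigma$-algebra of subsets of $X^{\infty,x_0}$ generated by the sets $A_1\times\cdots\times A_n:=\{\omega\in\{x_0\}\times A_1\times\cdots\times A_n\times X\times X\times\cdots\}$ with $A_1,\ldots,A_n\subset X$ Borel; $\mathcal{F}_0^{x_0}$ is trivial; $\mathcal{F}^{x_0}$ is the $\sigma$-algebra generated by $\bigcup_{n\ge1}\mathcal{F}_n^{x_0}$. The coordinate maps are $x_n(\omega)=x_n$. Strategies. A strategy of Player I (resp. II) is a collection $\sigma_I=\{\sigma_I^n\}_{n\ge0}$ (resp. $\sigma_{II}=\{\sigma_{II}^n\}_{n\ge0}$) of Borel functions $\sigma_I^n,\sigma_{II}^n:X^{n+1}\to X$ with $\sigma_I^n(x_0,\ldots,x_n),\ \sigma_{II}^n(x_0,\ldots,x_n)\in B_\epsilon(x_n)\cap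 X$. Stopping times. A stopping time is a map $\tau:X^{\infty,x_0}\to\mathbb{N}\cup\{+\infty\}$ (with $0\in\mathbb{N}$) such that $\tau^{-1}(\{0,\ldots,n\})\in\mathcal{F}_n^{x_0}$ for all $n\ge0$. The exit time is $\tau_0(\omega)=\min\{n\ge0: x_n(\omega)\in\Gamma\}$, with $\min\emptyset=+\infty$. The players choose stopping times $\tau_I,\tau_{II}$ with $\tau_I,\tau_{II}\le\tau_0$ everywhere. For a stopping time $\tau$ put $$A_n^\tau=\{(x_0,\ldots,x_n):\ \exists\,\omega=(x_0,\ldots,x_n,x_{n+1},\ldots)\in X^{\infty,x_0},\ \tau(\omega)\le n\}.$$ Let $A_n^{\tau_I<\tau_{II}}$ be the set of histories $(x_0,\ldots,x_n)$ such that for some $0\le k\le n$ one has $(x_0,\ldots,x_k)\in A_k^{\tau_I}\setminus A_k^{\tau_{II}}$. Probability measures. Given $\sigma_I,\sigma_{II}$ and a stopping time $\tau\le\tau_0$, define for $n\ge0$ and each history $(x_0,\ldots,x_n)$ the Borel probability measure on $X$ $$\gamma_n[x_0,\ldots,x_n]=\begin{cases}\dfrac{\alpha}{2}\delta_{\sigma_I^n(x_0,\ldots,x_n)}+\dfrac{\alpha}{2}\delta_{\sigma_{II}^n(x_0,\ldots,x_n)}+\beta\,\dfrac{\mathcal{L}_N\lfloor B_\epsilon(x_n)}{|B_\epsilon(x_n)|} & \text{if } (x_0,\ldots,x_n)\notin A_n^\tau,\\ \delta_{x_n} & \text{otherwise,}\end{cases}$$ where $\delta_y$ is the Dirac measure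 at $y$ and $\mathcal{L}_N\lfloor B_\epsilon(x_n)$ is $N$-dimensional Lebesgue measure restricted to $B_\epsilon(x_n)$. Then $\mathbb{P}^{x_0}_{\sigma_I,\sigma_{II},\tau}$ is the unique probability measure on $(X^{\infty,x_0},\mathcal{F}^{x_0})$ (given by Kolmogorov's theorem) with $$\mathbb{P}^{x_0}_{\sigma_I,\sigma_{II},\tau}(A_1\times\cdots\times A_n)=\int_{A_1}\cdots\int_{A_n}1\ \mathrm{d}\gamma_{n-1}[x_0,\ldots,x_{n-1}]\cdots\mathrm{d}\gamma_0[x_0]$$ for all $n\ge1$ and Borel $A_1,\ldots,A_n\subset X$; $\mathbb{E}^{x_0}_{\sigma_I,\sigma_{II},\tau}$ is its expectation. It is known that, since $\beta>0$, $\tau<\infty$ almost surely under $\mathbb{P}^{x_0}_{\sigma_I,\sigma_{II},\tau}$. Payoff. For $n\ge0$, $$G_n^{\tau_I,\tau_{II}}(x_0,\ldots,x_n)=\begin{cases}F(x_n) & \text{if } x_n\in\Gamma,\\ \Psi_1(x_n) & \text{if } x_n\in\Omega \text{ and } (x_0,\ldots,x_n)\in A_n^{\tau_I<\tau_{II}},\\ \Psi_2(x_n) & \text{otherwise,}\end{cases}$$ and $G^{\tau_I,\tau_{II}}_{\tau_I\wedge\tau_{II}}(\omega)=G_n^{\tau_I,\tau_{II}}(x_0,\ldots,x_n)$ with $n=(\tau_I\wedge\tau_{II})(\omega)$, where $\tau_I\wedge\tau_{II}=\min\{\tau_I,\tau_{II}\}$ (defined almost surely). In the definitions of $u_I$ and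 $u_{II}$ the suprema and infima run over all strategies $\sigma_I$ of Player I and $\sigma_{II}$ of Player II (collections of Borel functions $\sigma_I^n,\sigma_{II}^n:X^{n+1}\to X$, $n\ge0$, whose values at $(x_0,\ldots,x_n)$ lie in $B_\epsilon(x_n)\cap X$) and all stopping times $\tau_I,\tau_{II}:X^{\infty,x_0}\to\mathbb{N}\cup\{+\infty\}$ with respect to the filtration $\{\mathcal{F}_n^{x_0}\}_{n\ge0}$ satisfying $\tau_I\le\tau_0$ and $\tau_{II}\le\tau_0$ everywhere on $X^{\infty,x_0}$. *)

(* Defs.v *)
From HB Require Import structures.
From mathcomp Require Import all_boot all_order all_algebra.
From mathcomp Require Import all_classical all_reals all_analysis.

Set Implicit Arguments.
Unset Strict Implicit.
Unset Printing Implicit Defensive.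

Import Order.TTheory GRing.Theory Num.Theory.
Import numFieldNormedType.Exports.

Local Open Scope classical_set_scope.
Local Open Scope ring_scope.

(* Borel sigma-algebra.  The library topology of 'M[R]_(m, n) comes from the
   max norm, hence is the Euclidean one. *)
HB.instance Definition _ (R : realType) (m n : nat) :=
  @isMeasurable.Build (sigma_display (@open 'M[R]_(m, n))) 'M[R]_(m, n)
    <<s @open 'M[R]_(m, n) >> (@sigma_algebra0 _ setT _) (@sigma_algebraC _ _)
    (@sigma_algebra_bigcup _ setT _).

Section Euclidean.
Context {R : realType} {N : nat}.
Implicit Types x y : 'rV[R]_N.

Definition dot x y : R := \sum_(i < N) x ord0 i * y ord0 i.

Definition enorm x : R := Num.sqrt (dot x x).

(* The library's `ball` and norm on 'rV[R]_N are those of the max norm. *)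
Definition eball x (r : R) : set 'rV[R]_N := [set y | enorm (y - x) < r].

Definition dist x (A : set 'rV[R]_N) : R := inf [set enorm (x - y) | y in A].

(* Near each boundary point, A is the strict epigraph, in some unit direction
   e, of a Lipschitz function g of the component orthogonal to e. *)
Definition lipschitz_boundary (A : set 'rV[R]_N) : Prop :=
  forall p, (closure A `\` A°) p ->
  exists (r : R) (e : 'rV[R]_N) (g : 'rV[R]_N -> R),
    [/\ 0 < r, enorm e = 1, [lipschitz g y | y in setT] &
      forall y, eball p r y -> A y <-> g (y - dot y e *: e) < dot y e].

Definition lipschitz_domain (A : set 'rV[R]_N) : Prop :=
  [/\ A !=set0, open A, connected A, bounded_set A & lipschitz_boundary A].

End Euclidean.

(* N-dimensional Lebesgue measure on Borel sets: L_0 is the unit mass on R^0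
   and L_(n+1) is the image of L_1 \x L_n under (a, v) |-> (a, v_1, ..., v_n). *)
Fixpoint lebesgueN (R : realType) (n : nat) : set 'rV[R]_n -> \bar R :=
  match n return set 'rV[R]_n -> \bar R with
  | 0 => @dirac _ 'rV[R]_0 0 R
  | m.+1 =>
    pushforward (product_measure1 (@lebesgue_measure R) (@lebesgueN R m))
      (fun p : R * 'rV[R]_m => @row_mx R 1 1 m (const_mx p.1) p.2)
  end.

(* Possibly infinite times; None stands for +oo. *)
Definition by_time (t : option nat) (n : nat) : bool :=
  if t is Some m then (m <= n)%N else false.

Definition time_le (s t : option nat) : bool :=
  if t is Some n then by_time s n else true.

Definition time_min (s t : option nat) : option nat :=
  match s, t with
  | Some m, Some n => Some (minn m n)
  | Some m, None => Some m
  | None, _ => t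
  end.

Section Game.
Context {R : realType} {N : nat}.
Local Notation E := 'rV[R]_N.
Context (Omega : set E) (eps0 : R).

Definition collar : set E := [set x | ~ Omega x /\ dist x Omega < eps0].

Definition region : set E := collar `|` Omega.

Definition history_space (n : nat) : set (n.+1.-tuple E) :=
  [set h | forall i, region (tnth h i)].

Definition hlast (n : nat) (h : n.+1.-tuple E) : E := tnth h ord_max.

(* Functions on X^{oo,x0} are represented by functions on all sequences
   nat -> E, of which only the values on path_space x0 matter. *)
Definition path_space (x0 : E) : set (nat -> E) :=
  [set w | w 0%N = x0 /\ forall n, region (w n.+1)].

Definition history (n : nat) (w : nat -> E) : n.+1.-tuple E :=
  [tuple w i | i < n.+1].

Definition cylinder (x0 : E) (A : nat -> set E) (n : nat) : set (nat -> E) :=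
  [set w | path_space x0 w /\
           forall i, (1 <= i <= n)%N -> A i (w i)].

Definition borel_factors (A : nat -> set E) : Prop :=
  forall i, measurable (A i) /\ A i `<=` region.

(* A sigma-algebra on the set path_space x0; for n = 0 it is trivial. *)
Definition filtration (x0 : E) (n : nat) : set (set (nat -> E)) :=
  <<s path_space x0, [set cylinder x0 A n | A in borel_factors] >>.

(* The trace of this sigma-algebra on path_space x0 (which is one of the
   generators) is F^{x0}, and the complement of path_space x0 is an atom. *)
Definition path_type (x0 : E) :=
  g_sigma_algebraType (\bigcup_(n in [set n | (1 <= n)%N]) filtration x0 n).

Definition strategy := forall n : nat, n.+1.-tuple E -> E.

Definition is_strategy (eps : R) (s : strategy) : Prop :=
  forall n, measurable_fun (@history_space n) (s n) /\
    forall h, history_space h -> (eball (hlast h) eps `&` region) (s n h).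

Definition time := (nat -> E) -> option nat.

Definition is_stopping_time (x0 : E) (tau : time) : Prop :=
  forall n, filtration x0 n [set w | path_space x0 w /\ by_time (tau w) n].

Definition exit_time : time := fun w =>
  match pselect (exists n, w n \in collar) with
  | left ex => Some (ex_minn ex)
  | right _ => None
  end.

(* Pairs (strategy, stopping time) available to each player. *)
Definition plays (eps : R) (x0 : E) : set (strategy * time) :=
  [set p | [/\ is_strategy eps p.1, is_stopping_time x0 p.2 &
    forall w, path_space x0 w -> time_le (p.2 w) (exit_time w)]].

Definition stopped (x0 : E) (tau : time) (n : nat) : set (n.+1.-tuple E) :=
  [set h | exists w,
    [/\ path_space x0 w, history n w = h & by_time (tau w) n]].

(* The prefix (x_0, ..., x_k) of h is [tuple h`_i | i < k.+1] as k <= n. *)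
Definition first_stopped (x0 : E) (tI tII : time) (n : nat) :
    set (n.+1.-tuple E) :=
  [set h | exists2 k, (k <= n)%N &
    (@stopped x0 tI k `\` @stopped x0 tII k) [tuple h`_i | i < k.+1]].

Context (eps alpha beta : R).

Definition transition (x0 : E) (sI sII : strategy) (tau : time)
    (n : nat) (h : n.+1.-tuple E) : set E -> \bar R := fun B =>
  if h \in @stopped x0 tau n then dirac (hlast h) B
  else ((alpha / 2)%:E * dirac (sI n h) B + (alpha / 2)%:E * dirac (sII n h) B
        + beta%:E * (lebesgueN (B `&` eball (hlast h) eps)
                     / lebesgueN (eball (hlast h) eps)))%E.

(* Integral of 1 over A_(n+1), ..., A_(n+k) against the transitions from the
   history h = (x_0, ..., x_n). *)
Fixpoint iterated_integral (x0 : E) (sI sII : strategy) (tau : time)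
    (A : nat -> set E) (k n : nat) (h : n.+1.-tuple E) : \bar R :=
  if k is k'.+1 then
    \int[transition x0 sI sII tau h]_(y in A n.+1)
      iterated_integral x0 sI sII tau A k' [tuple of rcons h y]
  else 1%E.

Definition is_game_law (x0 : E) (sI sII : strategy) (tau : time)
    (P : probability (path_type x0) R) : Prop :=
  forall (A : nat -> set E) (n : nat), borel_factors A -> (1 <= n)%N ->
    P (cylinder x0 A n) = iterated_integral x0 sI sII tau A n [tuple x0].

(* `get` picks the only measure satisfying is_game_law: existence is the
   Kolmogorov extension theorem, uniqueness holds as cylinders generate. *)
Definition game_law (x0 : E) (sI sII : strategy) (tau : time) :
    probability (path_type x0) R :=
  get [set P | is_game_law sI sII tau P].

Context (F Psi1 Psi2 : E -> R).

Definition payoff (x0 : E) (tI tII : time) (n : nat) (h : n.+1.-tuple E) : R :=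
  let x := hlast h in
  if x \in collar then F x
  else if (x \in Omega) && (h \in @first_stopped x0 tI tII n) then Psi1 x
  else Psi2 x.

Definition min_time (tI tII : time) : time := fun w => time_min (tI w) (tII w).

(* The value 0 on the null event min_time tI tII w = +oo is immaterial. *)
Definition stopped_payoff (x0 : E) (tI tII : time) (w : nat -> E) : R :=
  if min_time tI tII w is Some n then payoff x0 tI tII (history n w) else 0.

Definition expected_payoff (x0 : E) (pI pII : strategy * time) : \bar R :=
  \int[game_law x0 pI.1 pII.1 (min_time pI.2 pII.2)]_(w in path_space x0)
    (stopped_payoff x0 pI.2 pII.2 w)%:E.

Definition value_I (x0 : E) : \bar R :=
  ereal_sup [set ereal_inf [set expected_payoff x0 pI pII
    | pII in plays eps x0] | pI in plays eps x0].

Definition value_II (x0 : E) : \bar R :=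
  ereal_inf [set ereal_sup [set expected_payoff x0 pI pII
    | pI in plays eps x0] | pII in plays eps x0].

Definition mean_operator (u : E -> R) (x : E) : R :=
  let B := eball x eps in
  alpha / 2 * sup (u @` B) + alpha / 2 * inf (u @` B)
  + beta / fine (lebesgueN B) * fine (\int[@lebesgueN R N]_(y in B) (u y)%:E).

Definition obstacle_solution (u : E -> R) : Prop :=
  [/\ measurable_fun region u,
      forall x, Omega x ->
        u x = Num.max (Psi1 x) (Num.min (Psi2 x) (mean_operator u x)) &
      forall x, collar x -> u x = F x].

End Game.

(* Main.v *)
From HB Require Import structures.
Require Import Defs.
From mathcomp Require Import all_boot all_order all_algebra.
From mathcomp Require Import all_classical all_reals all_analysis measurable_realfun.
From mathcomp Require Import ring lra.

(** Each player can secure [u x0] up to an arbitrary [eta > 0].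

    Player I moves, at the turn [n], to a point of the ball where [u] is maximal
    up to [eta / 2 ^ n.+1], and stops as soon as [u <= Psi1] or the token reaches
    the collar. While the game runs, [u > Psi1], so the equation bounds [u] by its
    mean operator, and the mean operator is at most the expected value of [u]
    after the next move plus the error, whatever Player II does. So [u] is a
    submartingale up to a summable error. When the game stops, [u] is at most the
    payoff: the payoff is [F = u] on the collar; it is [Psi1] only if Player I
    stopped, where [u <= Psi1]; otherwise it is [Psi2], and [u <= Psi2] always.
    Optional stopping gives an expected payoff of at least [u x0 - eta]
    ([playerI_guarantee]). Player II plays the mirror image of this strategy
    ([playerII_guarantee]). Therefore the upper value is at most [u x0] and the
    lower value at least [u x0], and the lower value never exceeds the upper one.

    Three ingredients support this argument.

    - The game stops almost surely ([play_stops]). The random part of each move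
      pushes the token in the direction of the first coordinate with probability
      bounded below, so a suitable exponential of this coordinate gives a
      Lyapunov function, and the probability that the game still runs after [m]
      moves decays geometrically.

    - The law of the game is a limit of laws of games of finite length. The
      transitions freeze a stopped history, so the part of the law carried by the
      paths that stop at step [k] is known after [k] moves; the sum of these
      parts ([absorbed_law]) has total mass 1 because the game stops, and it gives
      cylinders the prescribed probabilities ([absorbed_law_cylinder]). Cylinders
      form a generating pi-system, so it is the law of the game
      ([path_law_unique], [game_lawE]). Optional stopping becomes an induction on
      the number of moves followed by a passage to the limit
      ([absorbed_law_submartingale], [play_bound]).

    - Almost maximal points can be chosen in a Borel way
      ([almost_maximal_selection]), by the Lindelof property of open balls. *)

Set Implicit Arguments.
Unset Strict Implicit.
Unset Printing Implicit Defensive.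

Import Order.TTheory GRing.Theory Num.Theory.
Import numFieldNormedType.Exports.

Local Open Scope classical_set_scope.
Local Open Scope ring_scope.

(** * The Euclidean norm *)

Section EuclideanNorm.
Context {R : realType} {N : nat}.
Implicit Types x y z : 'rV[R]_N.

Lemma dot_ge0 x : 0 <= dot x x.
Proof. by apply: sumr_ge0 => i _; rewrite -expr2 sqr_ge0. Qed.

Lemma enorm_ge0 x : 0 <= enorm x.
Proof. exact: sqrtr_ge0. Qed.

Lemma enorm_sqr x : enorm x ^+ 2 = dot x x.
Proof. by rewrite sqr_sqrtr// dot_ge0. Qed.

Lemma dotDl x y z : dot (x + y) z = dot x z + dot y z.
Proof.
by rewrite /dot -big_split; apply: eq_bigr => i _; rewrite mxE mulrDl.
Qed.

Lemma dotC x y : dot x y = dot y x.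
Proof. by apply: eq_bigr => i _; rewrite mulrC. Qed.

Lemma dotZl (a : R) x y : dot (a *: x) y = a * dot x y.
Proof. by rewrite /dot mulr_sumr; apply: eq_bigr => i _; rewrite mxE mulrA. Qed.

Lemma enorm0 : enorm (0 : 'rV[R]_N) = 0.
Proof.
rewrite /enorm /dot big1 ?sqrtr0// => i _; by rewrite mxE mul0r.
Qed.

Lemma enormN x : enorm (- x) = enorm x.
Proof.
by congr Num.sqrt; apply: eq_bigr => i _; rewrite mxE mulrNN.
Qed.

Lemma enormC x y : enorm (x - y) = enorm (y - x).
Proof. by rewrite -opprB enormN. Qed.

Lemma enorm_eq0 x : enorm x = 0 -> x = 0.
Proof.
move=> x0; have : dot x x = 0 by rewrite -enorm_sqr x0 expr0n.
move=> /eqP; rewrite psumr_eq0 => [/allP h|i _]; last by rewrite -expr2 sqr_ge0.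
apply/rowP => i; rewrite mxE.
by have := h i (mem_index_enum i); rewrite mulf_eq0 orbb => /eqP.
Qed.

(** The square of the norm of [enorm y *: x - enorm x *: y] is nonnegative, and
    equals [2 * enorm x * enorm y * (enorm x * enorm y - dot x y)]. *)
Lemma cauchy_schwarz x y : dot x y <= enorm x * enorm y.
Proof.
have [x0|x0] := eqVneq (enorm x) 0.
  rewrite x0 mul0r (enorm_eq0 x0) /dot big1// => i _; by rewrite mxE mul0r.
have [y0|y0] := eqVneq (enorm y) 0.
  rewrite y0 mulr0 (enorm_eq0 y0) /dot big1// => i _; by rewrite mxE mulr0.
have xgt : 0 < enorm x by rewrite lt0r x0 enorm_ge0.
have ygt : 0 < enorm y by rewrite lt0r y0 enorm_ge0.
have := dot_ge0 (enorm y *: x + (- enorm x) *: y).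
rewrite dotDl !dotZl !(dotC _ (_ + _)) !dotDl !dotZl -!enorm_sqr (dotC y x).
set a := enorm x in xgt *; set b := enorm y in ygt *; set d := dot x y.
rewrite (_ : _ + _ = (2 * a * b) * (a * b - d)); last by ring.
by rewrite pmulr_rge0 ?subr_ge0// !mulr_gt0.
Qed.

Lemma enormD x y : enorm (x + y) <= enorm x + enorm y.
Proof.
rewrite -(@ler_pXn2r _ 2)// ?nnegrE ?addr_ge0 ?enorm_ge0//.
rewrite enorm_sqr sqrrD !enorm_sqr dotDl !(dotC _ (x + y)) !dotDl (dotC y x).
have := cauchy_schwarz x y; lra.
Qed.

Lemma enorm_coord x i : `|x ord0 i| <= enorm x.
Proof.
rewrite -sqrtr_sqr ler_wsqrtr// /dot (bigD1 i)//= expr2 lerDl.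
by apply: sumr_ge0 => j _; rewrite -expr2 sqr_ge0.
Qed.

Lemma enorm_le x (r : R) : 0 <= r -> (forall i, `|x ord0 i| <= r) ->
  enorm x <= N%:R * r.
Proof.
move=> r0 xr.
rewrite -(@ler_pXn2r _ 2)// ?nnegrE ?mulr_ge0 ?enorm_ge0//.
rewrite enorm_sqr; apply: (@le_trans _ _ (\sum_(i < N) r ^+ 2)).
  apply: ler_sum => i _; rewrite -expr2 -real_normK ?num_real//.
  by rewrite ler_pXn2r// ?nnegrE.
rewrite sumr_const card_ord -[_ *+ N]mulr_natl exprMn ler_wpM2r ?sqr_ge0//.
by case: {xr x}N => [|n]; rewrite ?expr0n// expr2 ler_peMr// ler1n.
Qed.

Lemma eball_center x (r : R) : 0 < r -> eball x r x.
Proof. by rewrite /eball /= subrr enorm0. Qed.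

Lemma ball_rVP x y (e : R) :
  ball x e y <-> 0 < e /\ forall i, `|x ord0 i - y ord0 i| < e.
Proof.
split; first by move=> [e0 h]; split=> // i; exact: h.
by move=> [e0 h]; split => // j i; rewrite ord1; exact: h.
Qed.

(** The topology is that of the max norm, which bounds the Euclidean
    norm only up to the factor [N]; the radius [d] makes room for it. *)
Lemma open_eball x (r : R) : open (eball x r).
Proof.
rewrite openE => y yr; apply/nbhs_ballP.
pose d := (r - enorm (y - x)) / (N%:R + 1).
have N1 : 0 < N%:R + 1 :> R by rewrite ltr_wpDl.
have d0 : 0 < d by rewrite divr_gt0// subr_gt0.
exists d => //= z /ball_rVP[_ yz].
rewrite /eball /= -(subrK y z) -addrA.
apply: (le_lt_trans (enormD _ _)); rewrite -ltrBrDr.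
apply: (@le_lt_trans _ _ (N%:R * d)).
  apply: enorm_le => [|i]; first exact: ltW.
  by rewrite !mxE distrC; apply/ltW.
have -> : r - enorm (y - x) = (N%:R + 1) * d by rewrite /d; field; rewrite gt_eqF.
by rewrite ltr_pM2r// ltrDl.
Qed.

End EuclideanNorm.

(** * Borel sets of the Euclidean space *)

Section BorelRow.
Context {R : realType} {N : nat}.
Local Notation E := 'rV[R]_N.

Definition rat_box (b : 'rV[rat]_N * rat) : set E :=
  [set y | forall i, `|ratr (b.1 ord0 i) - y ord0 i| < ratr b.2].

Lemma rat_box_base (U : set E) x : open U -> U x ->
  exists b, rat_box b x /\ rat_box b `<=` U.
Proof.
rewrite openE => oU Ux; have /nbhs_ballP[e /= e0 xeU] := oU x Ux.
have [q /andP[q0 qe]] : exists q : rat, 0 < (ratr q : R) < e / 2.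
  have [|q] := @rat_in_itvoo R 0 (e / 2); first by rewrite divr_gt0.
  by rewrite in_itv/= => ?; exists q.
have cP i : exists c : rat, `|ratr c - x ord0 i| < ratr q.
  have [|c] := @rat_in_itvoo R (x ord0 i - ratr q) (x ord0 i + ratr q).
    by rewrite ltrBlDr -addrA ltrDl addr_gt0.
  by rewrite in_itv /= => ?; exists c; rewrite ltr_distl.
have [c cx] := choice cP.
exists (\row_i c i, q); split; first by move=> i; rewrite /= mxE.
move=> y yb; apply: xeU; apply/ball_rVP; split=> // i.
have := yb i; rewrite /= mxE => h1; have := cx i => h2.
have := ler_normD (x ord0 i - ratr (c i)) (ratr (c i) - y ord0 i).
rewrite addrA subrK => h3; apply: (le_lt_trans h3).
move: h2; rewrite distrC => h2; lra.
Qed.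

Definition rat_boxes : (set E)^nat := fun n =>
  if unpickle n is Some b then rat_box b else set0.

Lemma open_rat_boxes (U : set E) : open U ->
  U = \bigcup_(n in [set n | rat_boxes n `<=` U]) rat_boxes n.
Proof.
move=> oU; apply/seteqP; split => [x Ux|x [n /= h]]; last exact: h.
have [b [xb bU]] := rat_box_base oU Ux.
by exists (pickle b) => /=; rewrite /rat_boxes pickleK.
Qed.

(** One member of the cover is chosen for each box of the countable base that
    fits into some member; the boxes alone already exhaust the union. *)
Lemma lindelof (I : Type) (D : set I) (U : I -> set E) :
  (forall i, open (U i)) -> D !=set0 ->
  exists f : nat -> I, (forall n, D (f n)) /\
    \bigcup_(i in D) U i = \bigcup_n U (f n).
Proof.
move=> oU [i0 Di0].
have /choice[f fP] : forall n, exists i, D i /\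
    ((exists2 j, D j & rat_boxes n `<=` U j) -> rat_boxes n `<=` U i).
  move=> n; have [[j Dj nj]|h] := pselect (exists2 j, D j & rat_boxes n `<=` U j).
    by exists j.
  by exists i0.
exists f; split=> [n|]; first by have [] := fP n.
apply/seteqP; split=> [x [i Di Uix]|x [n _ Ux]]; last by exists (f n)=> //; have [] := fP n.
have [b [xb bU]] := rat_box_base (oU i) Uix.
exists (pickle b) => //; have [_] := fP (pickle b).
by apply; [exists i; rewrite // /rat_boxes pickleK|rewrite /rat_boxes pickleK].
Qed.

Lemma open_measurable_rV (U : set E) : open U -> measurable U.
Proof. by move=> oU; apply: sub_sigma_algebra. Qed.

Lemma measurable_coord i : measurable_fun [set: E] (fun x : E => x ord0 i).
Proof.
apply: (measurability _ (RGenOpens.measurableE R)) => _ [_ [a [b ->]] <-].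
rewrite setTI; apply: open_measurable_rV; apply: open_comp; last exact: interval_open.
by move=> x _; exact: coord_continuous.
Qed.

(** Open sets are countable unions of boxes, and a box only constrains the
    coordinates. *)
Lemma measurable_fun_rV d (T : measurableType d) (D : set T) (f : T -> E) :
  (forall i, measurable_fun D (fun t => f t ord0 i)) -> measurable_fun D f.
Proof.
move=> mf mD; have mf' i := mf i mD.
apply: (@measurability _ _ T E D f (@open E)) => // _ [U oU <-].
rewrite [U]open_rat_boxes// preimage_bigcup setI_bigcupr.
apply: bigcup_measurable => n _; rewrite /rat_boxes.
case: unpickle => [b|]; last by rewrite preimage_set0 setI0.
rewrite (_ : _ `&` _ = D `&` \bigcap_(i in [set: 'I_N]) (D `&` (fun t => f t ord0 i) @^-1`
    [set r | `|ratr (b.1 ord0 i) - r| < ratr b.2])); last first.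
  apply/seteqP; split=> t [Dt tb]; split=> //; first by move=> i _; split=> //; exact: tb.
  by move=> i; have [] := tb i I.
apply: measurableI => //; apply: fin_bigcap_measurable; first exact: finite_finset.
move=> i _; apply: mf' => //; rewrite (_ : mkset _ = ball (ratr (b.1 ord0 i) : R) (ratr b.2))//.
exact: measurable_ball.
Qed.

Lemma measurable_eball (x : E) (r : R) : measurable (eball x r).
Proof. apply: open_measurable_rV; exact: open_eball. Qed.

Lemma measurable_set1_rV (x : E) : measurable [set x].
Proof.
rewrite (_ : [set x] = \bigcap_i (fun y : E => y ord0 i) @^-1` [set x ord0 i]).
  apply: fin_bigcap_measurable => [|i _]; first exact: finite_finset.
  by rewrite -[X in measurable X]setTI; exact: measurable_coord.
apply/seteqP; split=> [_ -> //|y xy]; apply/rowP => i; exact: xy.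
Qed.

Lemma measurable_enorm : measurable_fun [set: E] (@enorm R N).
Proof.
rewrite (_ : @enorm R N = Num.sqrt \o (fun x => dot x x))//.
apply: measurableT_comp; first by apply: continuous_measurable_fun; exact: sqrt_continuous.
by apply: measurable_sum => i; apply: measurable_funM; exact: measurable_coord.
Qed.

Lemma measurable_subr d (T : measurableType d) (D : set T) (f g : T -> E) :
  measurable_fun D f -> measurable_fun D g ->
  measurable_fun D (fun t => f t - g t).
Proof.
move=> mf mg; apply: measurable_fun_rV => i.
rewrite (_ : (fun t => _) = (fun t => f t ord0 i - g t ord0 i)); last first.
  by apply/funext => t; rewrite !mxE.
apply: measurable_funB;
  exact: (measurableT_comp (measurable_coord i)).
Qed.

End BorelRow.

(** * Lebesgue measure *)

Section SigmaFinitePackage.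
Context d (T : measurableType d) (R : realType) (m : {measure set T -> \bar R}).
Hypothesis m_fin : sigma_finite [set: T] m.

(** The proof is an argument of this copy of [m] so that the structure below can
    be attached to it. *)
Definition sigma_finite_copy (_ : sigma_finite [set: T] m) : set T -> \bar R :=
  m.

HB.instance Definition _ := Measure.on (sigma_finite_copy m_fin).
HB.instance Definition _ := @Measure_isSigmaFinite.Build d T R
  (sigma_finite_copy m_fin) m_fin.

Definition sigma_finite_pack : {sigma_finite_measure set T -> \bar R} :=
  sigma_finite_copy m_fin.

End SigmaFinitePackage.

Section Lebesgue.
Context {R : realType}.

Definition box n (z : 'rV[R]_n) (r : R) : set 'rV[R]_n :=
  [set y | forall i, `|z ord0 i - y ord0 i| < r].

Lemma measurable_box n (z : 'rV[R]_n) r : measurable (box z r).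
Proof.
rewrite (_ : box z r = \bigcap_(i in [set: 'I_n])
    ((fun y : 'rV[R]_n => y ord0 i) @^-1` ball (z ord0 i) r)).
  apply: fin_bigcap_measurable => [|i _]; first exact: finite_finset.
  rewrite -[X in measurable X]setTI; apply: measurable_coord => //.
  exact: measurable_ball.
by apply/seteqP; split=> y zy i; [move=> _; exact: zy|exact: (zy i I)].
Qed.

Lemma bigcup_box n : \bigcup_k @box n 0 k%:R = setT.
Proof.
apply/seteqP; split=> // y _.
have [k yk] : exists k : nat, \sum_i `|y ord0 i| < k%:R.
  exists (Num.truncn (\sum_i `|y ord0 i|)).+1; exact: truncnS_gt.
exists k => // i; rewrite mxE sub0r normrN; apply: le_lt_trans yk.
by rewrite (bigD1 i)//= lerDl sumr_ge0.
Qed.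

Let cons_row n (p : R * 'rV[R]_n) : 'rV[R]_n.+1 :=
  @row_mx R 1 1 n (const_mx p.1) p.2.

Let cons_row0 n (p : R * 'rV[R]_n) : cons_row p ord0 ord0 = p.1.
Proof.
transitivity ((const_mx p.1 : 'rV[R]_1) ord0 ord0); last by rewrite mxE.
have e : (ord0 : 'I_(1 + n)) = lshift n ord0 by exact: val_inj.
exact: etrans (congr1 (cons_row p ord0) e) (row_mxEl _ _ _ _).
Qed.

Let cons_rowS n (p : R * 'rV[R]_n) (i : 'I_n) :
  cons_row p ord0 (lift ord0 i) = p.2 ord0 i.
Proof.
have e : (lift ord0 i : 'I_(1 + n)) = rshift 1 i by exact: val_inj.
exact: etrans (congr1 (cons_row p ord0) e) (row_mxEr _ _ _ _).
Qed.

Let measurable_cons_row n : measurable_fun setT (@cons_row n).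
Proof.
apply: measurable_fun_rV => i; case: (unliftP ord0 i) => [j ->|->].
  rewrite (_ : (fun t => _) = (fun v : 'rV[R]_n => v ord0 j) \o snd).
    by apply: measurableT_comp; [exact: measurable_coord|exact: measurable_snd].
  by apply/funext => p; rewrite cons_rowS.
rewrite (_ : (fun t => _) = fst); first exact: measurable_fst.
by apply/funext => p; rewrite cons_row0.
Qed.

(** Product measures need a sigma-finite second factor, so the induction carries
    the measure structure, its sigma-finiteness and the volume of cubes at the
    same time: the cubes centred at 0 exhaust the space. *)
Lemma lebesgueN_box_measure n :
  exists2 mu : {sigma_finite_measure set 'rV[R]_n -> \bar R},
    (mu : set _ -> \bar R) = @lebesgueN R n &
    forall z r, 0 <= r -> mu (box z r) = ((r *+ 2) ^+ n)%:E.
Proof.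
elim: n => [|n [mu muE mubox]].
  exists (@dirac _ 'rV[R]_0 0 R : {finite_measure set 'rV[R]_0 -> \bar R}) => //.
  move=> z r r0; rewrite expr0; rewrite /= /dirac indicE mem_set// => -[]//.
pose nu1 : {measure set 'rV[R]_n.+1 -> \bar R} :=
  pushforward ((@lebesgue_measure R) \x mu)%E (@cons_row n).
pose nu0 := nu1 (@measurable_cons_row n).
have nu0box z r : 0 <= r -> nu0 (box z r) = ((r *+ 2) ^+ n.+1)%:E.
  move=> r0.
  have -> : nu0 (box z r) = ((@lebesgue_measure R) \x mu)%E
     (ball (z ord0 ord0) r `*` box (\row_i z ord0 (lift ord0 i)) r).
    congr ((_ \x _)%E _); apply/seteqP; split=> -[a v] /=.
      move=> zr; split=> [|i]; first by have := zr ord0; rewrite cons_row0.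
      by have := zr (lift ord0 i); rewrite cons_rowS mxE.
    move=> [za zv] i; case: (unliftP ord0 i) => [j ->|->].
      by rewrite cons_rowS; have := zv j; rewrite mxE.
    by rewrite cons_row0.
  rewrite product_measure1E; [|exact: measurable_ball|exact: measurable_box].
  rewrite exprS EFinM; congr (_ * _)%E; last exact: mubox.
  exact: lebesgue_measure_ball.
have nu_fin : sigma_finite setT nu0.
  exists (fun k => box 0 k%:R) => [|k]; first by rewrite bigcup_box.
  by split; [exact: measurable_box|rewrite nu0box// ltry].
exists (sigma_finite_pack nu_fin) => //.
by rewrite /= /sigma_finite_copy /= -muE.
Qed.

End Lebesgue.

Lemma eball_sub_box {R : realType} N (x : 'rV[R]_N) r : eball x r `<=` box x r.
Proof.
move=> y yr i; rewrite distrC; have := enorm_coord (y - x) i.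
by rewrite !mxE => /le_lt_trans; exact.
Qed.

Lemma box_sub_eball {R : realType} N (x : 'rV[R]_N) s r :
  0 <= s -> N%:R * s < r -> box x s `<=` eball x r.
Proof.
move=> s0 sr y ys; apply: le_lt_trans sr; apply: enorm_le => // i.
by rewrite !mxE distrC; exact/ltW/ys.
Qed.

(** * The region of play *)

Section Region.
Context {R : realType} {N : nat} (Omega : set 'rV[R]_N) (eps0 : R).
Hypothesis Omega0 : Omega !=set0.
Hypothesis eps0_gt0 : 0 < eps0.
Local Notation E := 'rV[R]_N.
Local Notation X := (region Omega eps0).

Lemma dist_ltP (x : E) (e : R) :
  dist x Omega < e <-> exists2 y, Omega y & enorm (x - y) < e.
Proof.
have [z Oz] := Omega0.
have dist_inf : has_inf [set enorm (x - y) | y in Omega].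
  split; first by exists (enorm (x - z)); exists z.
  by exists 0 => _ [y _ <-]; exact: enorm_ge0.
split=> [/(inf_lt dist_inf.1)[_ [y Oy <-] ye]|[y Oy ye]]; first by exists y.
apply: le_lt_trans ye; apply: ge_inf; last by exists y.
by case: dist_inf.
Qed.

Lemma region_ballE : X = \bigcup_(y in Omega) eball y eps0.
Proof.
apply/seteqP; split=> [x [[_ /dist_ltP[y Oy xy]]|Ox]|x [y Oy xy]].
- by exists y.
- by exists x => //; exact: eball_center.
- have [Ox|nOx] := pselect (Omega x); first by right.
  by left; split => //; apply/dist_ltP; exists y.
Qed.

Lemma collarE : collar Omega eps0 = X `\` Omega.
Proof.
apply/seteqP; split=> x; first by move=> xc; split; [left|case: xc].
by move=> [[]].
Qed.

Lemma measurable_region : measurable X.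
Proof.
rewrite region_ballE; apply: open_measurable_rV.
by apply: bigcup_open => y _; exact: open_eball.
Qed.

Lemma measurable_collar : open Omega -> measurable (collar Omega eps0).
Proof.
move=> oO; rewrite collarE; apply: measurableD; first exact: measurable_region.
exact: open_measurable_rV.
Qed.

Lemma eball_sub_region (x : E) (eps : R) : eps <= eps0 -> Omega x ->
  eball x eps `<=` X.
Proof.
move=> le_eps Ox y yx; rewrite region_ballE; exists x => //.
exact: lt_le_trans yx le_eps.
Qed.

End Region.

(** * Histories and paths *)

Section PathSpace.
Context {R : realType} {N : nat} (Omega : set 'rV[R]_N) (eps0 : R).
Context (x0 : 'rV[R]_N).
Local Notation E := 'rV[R]_N.
Local Notation X := (region Omega eps0).
Local Notation path := (path_space Omega eps0 x0).
Local Notation W := (path_type Omega eps0 x0).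
Hypothesis Xx0 : X x0.
Hypothesis mX : measurable X.

Definition start_history : 1.-tuple E := [tuple x0].

Definition game_history n : set (n.+1.-tuple E) :=
  [set h | tnth h ord0 = x0 /\ history_space Omega eps0 h].

(** The path that rests for ever after a history: beyond the end of [h], [nth]
    returns its default value, the last position. *)
Definition stay n (h : n.+1.-tuple E) : W := fun i => nth (hlast h) h i.

(** The default value 0 is read only if [n < m]. *)
Definition history_prefix m n (h : n.+1.-tuple E) : m.+1.-tuple E :=
  [tuple h`_i | i < m.+1].
Arguments history_prefix m {n} h.

Definition extend n (h : n.+1.-tuple E) (y : E) : n.+2.-tuple E :=
  [tuple of rcons h y].

Lemma historyE n (w : nat -> E) i :
  (i <= n)%N -> (history n w)`_i = w i.
Proof.
by move=> ni; rewrite -[i]/(nat_of_ord (Ordinal (ni : i < n.+1)%N)) -tnth_nth tnth_mktuple.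
Qed.

Lemma prefix_history m n (w : nat -> E) : (m <= n)%N ->
  history_prefix m (history n w) = history m w.
Proof.
move=> mn; apply: eq_from_tnth => i; rewrite !tnth_mktuple historyE//.
by rewrite (leq_trans _ mn)// -ltnS.
Qed.

Lemma hlast_history n (w : nat -> E) : hlast (history n w) = w n.
Proof. by rewrite /hlast tnth_mktuple. Qed.

Lemma history_stay n (h : n.+1.-tuple E) : history n (stay h) = h.
Proof.
by apply: eq_from_tnth => i; rewrite tnth_mktuple (tnth_nth (hlast h)).
Qed.

Lemma stay_small n (h : n.+1.-tuple E) (i : 'I_n.+1) : stay h i = tnth h i.
Proof. by rewrite (tnth_nth (hlast h)). Qed.

Lemma stay_large n (h : n.+1.-tuple E) i : (n <= i)%N -> stay h i = hlast h.
Proof.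
rewrite leq_eqVlt => /orP[/eqP <-|ni].
  by rewrite -[n in LHS]/(nat_of_ord (@ord_max n)) stay_small.
by rewrite /stay nth_default// size_tuple.
Qed.

Lemma extend_tnth n (h : n.+1.-tuple E) y (i : 'I_n.+1) :
  tnth (extend h y) (widen_ord (leqnSn _) i) = tnth h i.
Proof.
by rewrite !(tnth_nth y)/= nth_rcons size_tuple ltn_ord.
Qed.

Lemma hlast_extend n (h : n.+1.-tuple E) y : hlast (extend h y) = y.
Proof.
by rewrite /hlast (tnth_nth y)/= nth_rcons size_tuple ltnn eqxx.
Qed.

Lemma history_stay_extend n (h : n.+1.-tuple E) y :
  history n (stay (extend h y)) = h.
Proof.
apply: eq_from_tnth => i; rewrite tnth_mktuple -(extend_tnth h y) -stay_small.
by [].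
Qed.

Lemma stay_extend_hlast n (h : n.+1.-tuple E) :
  stay (extend h (hlast h)) = stay h.
Proof.
apply/funext => i; have [ni|ni] := ltnP i n.+1.
  rewrite -[i]/(nat_of_ord (Ordinal ni)) [RHS]stay_small -(extend_tnth h (hlast h)).
  by rewrite -stay_small.
by rewrite !stay_large// ?hlast_extend// ltnW.
Qed.

Lemma game_history_path n (w : nat -> E) : path w -> game_history (history n w).
Proof.
move=> [w0 wX]; split; first by rewrite tnth_mktuple.
by move=> i; rewrite tnth_mktuple; case: (nat_of_ord i) => [|k]; rewrite ?w0.
Qed.

Lemma game_history_stay n (h : n.+1.-tuple E) :
  game_history h <-> path (stay h).
Proof.
split=> [[h0 hX]|/(@game_history_path n)]; last by rewrite history_stay.
split; first by rewrite -[0%N]/(nat_of_ord (@ord0 n)) stay_small.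
move=> i; have [ni|ni] := ltnP i.+1 n.+1.
  by rewrite -[i.+1]/(nat_of_ord (Ordinal ni)) stay_small.
by rewrite stay_large ?(ltnW ni)//; exact: hX.
Qed.

Lemma game_history_extend n (h : n.+1.-tuple E) y :
  game_history (extend h y) <-> game_history h /\ X y.
Proof.
have e0 : tnth (extend h y) ord0 = tnth h ord0.
  by rewrite -(extend_tnth h y); congr tnth; exact: val_inj.
split=> [[h0 hX]|[[h0 hX] Xy]].
  split; last by have := hX ord_max; rewrite -/(hlast _) hlast_extend.
  by split; [rewrite -e0|move=> i; rewrite -(extend_tnth h y)].
split; first by rewrite e0.
move=> i; have [ni|ni] := ltnP i n.+1.
  rewrite (_ : i = widen_ord (leqnSn _) (Ordinal ni)) ?extend_tnth//.
  exact: val_inj.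
rewrite (_ : i = ord_max) -/(hlast _) ?hlast_extend//.
by apply/val_inj/eqP; rewrite /= eqn_leq ni andbT -ltnS.
Qed.

Lemma game_history_start : game_history start_history.
Proof.
split=> [|i]; first by rewrite (tnth_nth x0).
by rewrite ord1 (tnth_nth x0).
Qed.

Lemma hlast_start : hlast start_history = x0.
Proof. by rewrite /hlast ord1 (tnth_nth x0). Qed.

Lemma measurable_extend n :
  measurable_fun setT (fun p : n.+1.-tuple E * E => extend p.1 p.2).
Proof.
apply/measurable_fun_tnthP => i; have [ni|ni] := ltnP i n.+1.
  rewrite (_ : _ \o _ = (fun h => tnth h (Ordinal ni)) \o fst); last first.
    apply/funext => -[h y] /=; rewrite -(extend_tnth h y).
    by congr tnth; exact: val_inj.
  apply: measurableT_comp; first exact: measurable_tnth.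
  exact: measurable_fst.
rewrite (_ : _ \o _ = snd); first exact: measurable_snd.
apply/funext => -[h y] /=; rewrite -[RHS](hlast_extend h y) /hlast.
congr tnth; apply/val_inj/eqP; rewrite /= eqn_leq ni andbT -ltnS; exact: ltn_ord.
Qed.

Lemma measurable_prefix m n : measurable_fun setT (@history_prefix m n).
Proof.
apply/measurable_fun_tnthP => i; have [ni|ni] := ltnP i n.+1.
  rewrite (_ : _ \o _ = (fun h => tnth h (Ordinal ni))).
    exact: measurable_tnth.
  by apply/funext => h /=; rewrite tnth_mktuple (tnth_nth 0).
rewrite (_ : _ \o _ = cst 0); first exact: measurable_cst.
by apply/funext => h /=; rewrite tnth_mktuple nth_default// size_tuple.
Qed.

Lemma measurable_history_space n :
  measurable (@history_space R N Omega eps0 n).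
Proof.
rewrite (_ : @history_space R N Omega eps0 n =
    \bigcap_(i in [set: 'I_n.+1]) [set h : n.+1.-tuple E | X (tnth h i)]).
  apply: fin_bigcap_measurable => [|i _]; first exact: finite_finset.
  by rewrite -[X in measurable X]setTI; exact: measurable_tnth.
by apply/seteqP; split=> [h hX i _|h hX i]; [exact: hX|exact: (hX i I)].
Qed.

Lemma measurable_game_history n : measurable (@game_history n).
Proof.
apply: measurableI; last exact: measurable_history_space.
rewrite -[X in measurable X]setTI.
apply: (measurable_tnth ord0 measurableT (Y := [set x0])).
exact: measurable_set1_rV.
Qed.

(** Both sides are sigma-algebras on the set of paths, and each contains the
    generators of the other: a cylinder restricts coordinates one at a time, and
    the coordinate 0, which cylinders leave free, is constant on paths. *)
Lemma filtrationP n (S : set (nat -> E)) :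
  filtration Omega eps0 x0 n S <->
  exists2 B : set (n.+1.-tuple E), measurable B & S = path `&` history n @^-1` B.
Proof.
split.
  apply: (smallest_sub (X := [set S | exists2 B : set (n.+1.-tuple E),
      measurable B & S = path `&` history n @^-1` B])).
    split.
    - by exists set0 => //; rewrite preimage_set0 setI0.
    - move=> _ [B mB ->]; exists (~` B); first exact: measurableC.
      by rewrite setDE setCI setIUr setICr set0U.
    - move=> F FB; have /choice[B BP] : forall i, exists B : set (n.+1.-tuple E),
          measurable B /\ F i = path `&` history n @^-1` B.
        by move=> i; have [B mB ->] := FB i; exists B.
      exists (\bigcup_i B i); first by apply: bigcup_measurable => i _; exact: (BP i).1.
      rewrite preimage_bigcup setI_bigcupr; apply: eq_bigcupr => i _.
      exact: (BP i).2.
  move=> _ [A AX <-].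
  exists (\bigcap_(i in [set i : 'I_n.+1 | (1 <= i)%N])
      [set h : n.+1.-tuple E | A i (tnth h i)]).
    apply: fin_bigcap_measurable => [|i _]; first exact: finite_finset.
    rewrite -[X in measurable X]setTI; apply: measurable_tnth => //.
    exact: (AX i).1.
  apply/seteqP; split=> w [pw wA]; split=> // i /=.
    by move=> i1; rewrite /= tnth_mktuple; apply: wA; rewrite i1 -ltnS/=.
  move=> /andP[i1 ni]; have := wA (Ordinal (ni : i < n.+1)%N) i1.
  by rewrite /= tnth_mktuple.
move=> [B mB ->].
have sgF : sigma_algebra path (filtration Omega eps0 x0 n).
  exact: smallest_sigma_algebra.
have [F0 FD FU] := sgF.
have Fpath : filtration Omega eps0 x0 n path by rewrite -[path]setD0; exact: FD.
suff : @measurable _ (n.+1.-tuple E) `<=`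
    [set B | filtration Omega eps0 x0 n (path `&` history n @^-1` B)] by exact.
apply: smallest_sub.
  split.
  - by rewrite /= preimage_set0 setI0.
  - move=> V FV /=; rewrite (_ : _ `&` _ = path `\` (path `&` history n @^-1` V)).
      exact: FD.
    apply/seteqP; split=> w [pw]; first by move=> [_ nV]; split=> // -[].
    by move=> nV; split=> //; split=> // Vw; apply: nV.
  - move=> V FV /=; rewrite preimage_bigcup setI_bigcupr; exact: FU.
rewrite -bigcup_mkord_ord => V [i /= ni [A mA] <-{V}]; rewrite setTI.
pose j : 'I_n.+1 := inord i.
have [j0|j0] := eqVneq (j : nat) 0%N.
  have [Ax|nAx] := pselect (A x0).
    rewrite (_ : _ `&` _ = path)//; apply/seteqP; split=> [w []//|w pw].
    split=> //=; rewrite tnth_mktuple j0; by case: pw => ->.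
  rewrite (_ : _ `&` _ = set0)//; apply/seteqP; split=> // w [pw] /=.
  by rewrite tnth_mktuple j0; case: pw => ->.
apply: sub_sigma_algebra; exists (fun k => if k == j :> nat then A `&` X else X).
  by move=> k; case: ifP => _; split=> //; exact: measurableI.
apply/seteqP; split=> w [pw wA]; split=> //=.
  have := wA j; rewrite lt0n j0 -ltnS ltn_ord eqxx => /(_ isT)[+ _].
  by rewrite tnth_mktuple.
move=> [|k]// kn; case: ifP => [/eqP kj|_]; last by case: pw.
split; last by case: pw.
by move: wA; rewrite /= tnth_mktuple -kj.
Qed.

Lemma filtration_mono m n : (m <= n)%N ->
  filtration Omega eps0 x0 m `<=` filtration Omega eps0 x0 n.
Proof.
move=> mn _ /filtrationP[B mB ->]; apply/filtrationP.
exists (@history_prefix m n @^-1` B).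
  by rewrite -[X in measurable X]setTI; exact: measurable_prefix.
by apply/seteqP; split=> w [pw /=]; rewrite ?prefix_history// => wB; split=> //=;
  rewrite prefix_history.
Qed.

Lemma filtration_measurable n (S : set W) :
  filtration Omega eps0 x0 n S -> measurable S.
Proof.
move=> FS; apply: sub_sigma_algebra; exists n.+1 => //.
exact: (filtration_mono (leqnSn n)).
Qed.

Lemma measurable_path : measurable (path : set W).
Proof.
apply: (@filtration_measurable 0); apply/filtrationP; exists setT => //.
by rewrite preimage_setT setIT.
Qed.

Lemma measurable_history n : measurable_fun (path : set W) (@history R N n).
Proof.
move=> _ B mB; apply: (@filtration_measurable n); apply/filtrationP.
by exists B.
Qed.

Lemma measurable_stay n : measurable_fun setT (@stay n).
Proof.
apply: (@measurability _ _ _ W setT (@stay n)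
  (\bigcup_(n in [set n | (1 <= n)%N]) filtration Omega eps0 x0 n)) => //.
move=> _ [S [m m1 /filtrationP[B mB ->]] <-]; rewrite setTI.
rewrite (_ : _ @^-1` _ = @game_history n `&`
    [set h | (fun h : n.+1.-tuple E => history m (stay h)) h \in B]); last first.
  apply/seteqP; split=> h [] /=; first by move=> /game_history_stay ? ?; rewrite inE.
  by rewrite inE => /game_history_stay.
apply: measurableI; first exact: measurable_game_history.
rewrite (_ : mkset _ = (fun h : n.+1.-tuple E => history m (stay h)) @^-1` B); last first.
  by apply/seteqP; split=> h /=; rewrite inE.
rewrite -[X in measurable X]setTI.
suff : measurable_fun setT (fun h : n.+1.-tuple E => history m (stay h)) by exact.
apply/measurable_fun_tnthP => i; have [ni|ni] := ltnP i n.+1.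
  rewrite (_ : _ \o _ = (fun h => tnth h (Ordinal ni))); first exact: measurable_tnth.
  by apply/funext => h /=; rewrite tnth_mktuple -stay_small.
rewrite (_ : _ \o _ = (fun h => tnth h ord_max)); first exact: measurable_tnth.
by apply/funext => h /=; rewrite tnth_mktuple stay_large// ltnW.
Qed.

End PathSpace.

Local Open Scope ereal_scope.

(** * Composition of kernels *)

Section IntegralTools.
Context d (T : measurableType d) (R : realType).

Lemma ge0_integral_mrestr (mu : {measure set T -> \bar R}) (D : set T)
    (mD : measurable D) (f : T -> \bar R) :
  (forall x, 0 <= f x) -> measurable_fun setT f ->
  \int[mrestr mu mD]_x f x = \int[mu]_(x in D) f x.
Proof.
move=> f0 mf; have mDC : measurable (~` D) by exact: measurableC.
rewrite (@ge0_negligible_integral _ _ _ _ setT (~` D))//.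
  rewrite setTD setCK; apply: eq_measure_integral => A mA AD.
  by rewrite [LHS]/= /mrestr setIidl.
by rewrite [LHS]/= /mrestr setICl measure0.
Qed.

Lemma ge0_integral_full (mu : {measure set T -> \bar R}) (D : set T)
    (f : T -> \bar R) :
  measurable D -> mu (~` D) = 0 ->
  (forall x, 0 <= f x) -> measurable_fun setT f ->
  \int[mu]_x f x = \int[mu]_(x in D) f x.
Proof.
move=> mD mu0 f0 mf; have mDC : measurable (~` D) by exact: measurableC.
by rewrite (@ge0_negligible_integral _ _ _ _ setT (~` D))// setTD setCK.
Qed.

End IntegralTools.

Section KernelTools.
Context d1 d2 d3 (X : measurableType d1) (Y : measurableType d2)
  (Z : measurableType d3) (R : realType).

Section Precomp.
Variables (k : R.-pker Y ~> Z) (phi : X -> Y).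
Hypothesis mphi : measurable_fun setT phi.

Definition kprecomp (_ : measurable_fun setT phi) :
  X -> {measure set Z -> \bar R} := fun x => k (phi x).

Let measurable_kprecomp U : measurable U ->
  measurable_fun [set: X] (kprecomp mphi ^~ U).
Proof.
by move=> mU; exact: (measurableT_comp (measurable_kernel k U mU) mphi).
Qed.

HB.instance Definition _ := isKernel.Build _ _ _ _ R (kprecomp mphi)
  measurable_kprecomp.

Let kprecomp_prob x : kprecomp mphi x [set: Z] = 1.
Proof. exact: prob_kernel. Qed.

HB.instance Definition _ := Kernel_isProbability.Build _ _ _ _ R
  (kprecomp mphi) kprecomp_prob.
End Precomp.

Section Step.
Variables (l : R.-pker X ~> Y) (k : R.-pker (X * Y) ~> Z).

Definition kstep : X -> {measure set Z -> \bar R} := mkcomp l k.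

HB.instance Definition _ := isKernel.Build _ _ _ _ R kstep
  (KCOMP_FINITE_KERNEL.measurable_fun_kcomp_finite l k).

Let kstep_prob x : kstep x [set: Z] = 1.
Proof.
rewrite /kstep/= /kcomp (eq_integral (cst 1)) => [|y _]; last exact: prob_kernel.
by rewrite integral_cst// prob_kernel mule1.
Qed.

HB.instance Definition _ := Kernel_isProbability.Build _ _ _ _ R
  kstep kstep_prob.
End Step.

End KernelTools.

(** * Markov chains that freeze when they stop *)

Section AbsorbedChain.
Context {R : realType} {N : nat} (Omega : set 'rV[R]_N) (eps0 : R).
Context (x0 : 'rV[R]_N).
Local Notation E := 'rV[R]_N.
Local Notation X := (region Omega eps0).
Local Notation path := (path_space Omega eps0 x0).
Local Notation W := (path_type Omega eps0 x0).
Local Notation stay := (@stay R N Omega eps0 x0 _).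
Local Notation game_history := (@game_history R N Omega eps0 x0 _).
Local Notation start := (start_history x0).
Hypothesis Xx0 : X x0.
Hypothesis mX : measurable X.

Variable gamma : forall n, R.-pker (n.+1.-tuple E) ~> E.
Variable S : forall n, set (n.+1.-tuple E).
Arguments S {n}.
Hypothesis mS : forall n, measurable (@S n).
Hypothesis S_extend : forall n (h : n.+1.-tuple E) y, S h -> S (extend h y).
Hypothesis gamma_S : forall n (h : n.+1.-tuple E) A, S h -> measurable A ->
  gamma n h A = \d_(hlast h) A.
Hypothesis gamma_region : forall n (h : n.+1.-tuple E), game_history h ->
  gamma n h (~` X) = 0.

(** The law of the path that makes [k] more moves after the history [h] and then
    rests: a finite composition of kernels. The infinite game is reached as a
    limit in [k]. *)
Fixpoint chain (k : nat) : forall n, R.-pker (n.+1.-tuple E) ~> W :=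
  match k with
  | 0 => fun n => kdirac (measurable_stay Xx0 mX (n := n))
  | k'.+1 => fun n => kstep (gamma n)
      (kprecomp (chain k' n.+1) (@measurable_extend R N n))
  end.

Lemma chain0 n (h : n.+1.-tuple E) A : chain 0 n h A = \d_(stay h) A.
Proof. by []. Qed.

Lemma chainS k n (h : n.+1.-tuple E) A :
  chain k.+1 n h A = \int[gamma n h]_y chain k n.+1 (extend h y) A.
Proof. by []. Qed.

Lemma measurable_extend1 n (h : n.+1.-tuple E) :
  measurable_fun setT (fun y => extend h y).
Proof.
exact: (measurableT_comp (@measurable_extend R N n) (pair1_measurable h)).
Qed.

Lemma measurable_chain_extend k n (h : n.+1.-tuple E) A : measurable A ->
  measurable_fun setT (fun y => chain k n.+1 (extend h y) A).
Proof.
move=> mA.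
exact: (measurableT_comp (measurable_kernel (chain k n.+1) A mA)
  (measurable_extend1 h)).
Qed.

Section ChainIntegral.
Variable f : W -> \bar R.
Hypothesis f0 : forall w, 0 <= f w.
Hypothesis mf : measurable_fun setT f.

Lemma integral_chain0 n (h : n.+1.-tuple E) :
  \int[chain 0 n h]_w f w = f (stay h).
Proof. by rewrite integral_dirac// diracT mul1e. Qed.

Lemma integral_chainS k n (h : n.+1.-tuple E) :
  \int[chain k.+1 n h]_w f w =
  \int[gamma n h]_y \int[chain k n.+1 (extend h y)]_w f w.
Proof.
exact: (integral_kcomp (gamma n)
  (kprecomp (chain k n.+1) (@measurable_extend R N n)) h f0 mf).
Qed.

Lemma measurable_integral_chain_extend k n (h : n.+1.-tuple E) :
  measurable_fun setT (fun y => \int[chain k n.+1 (extend h y)]_w f w).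
Proof.
apply: (measurable_fun_integral_kernel
  (l := fun y => chain k n.+1 (extend h y))) => // U mU.
exact: measurable_chain_extend.
Qed.

Lemma integral_gamma_S n (h : n.+1.-tuple E) (g : E -> \bar R) : S h ->
  measurable_fun setT g -> \int[gamma n h]_y g y = g (hlast h).
Proof.
move=> Sh mg; rewrite (eq_measure_integral (\d_(hlast h))).
  by rewrite integral_dirac// diracT mul1e.
by move=> A mA _; exact: gamma_S.
Qed.

Lemma chain_stopped k n (h : n.+1.-tuple E) : S h ->
  \int[chain k n h]_w f w = f (stay h).
Proof.
elim: k n h => [|k IH] n h Sh; first exact: integral_chain0.
rewrite integral_chainS integral_gamma_S//.
  by rewrite IH; [rewrite stay_extend_hlast|exact: S_extend].
exact: measurable_integral_chain_extend.
Qed.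

Lemma integral_chainS_region k n (h : n.+1.-tuple E) : game_history h ->
  \int[chain k.+1 n h]_w f w =
  \int[gamma n h]_(y in X) \int[chain k n.+1 (extend h y)]_w f w.
Proof.
move=> gh; rewrite integral_chainS; apply: ge0_integral_full => //.
- exact: gamma_region.
- by move=> y; exact: integral_ge0.
- exact: measurable_integral_chain_extend.
Qed.

Lemma gamma_X n (h : n.+1.-tuple E) : game_history h -> gamma n h X = 1.
Proof.
move=> gh; have := prob_kernel (s := gamma n) h; rewrite -(setUv X) measureU//.
- by rewrite [X in _ + X]gamma_region// adde0.
- exact: measurableC.
- by rewrite setICr.
Qed.

(** Almost every path continues the history that the chain starts from. *)
Lemma chain_const k n (h : n.+1.-tuple E) c : game_history h ->
  (forall w, path w -> history n w = h -> f w = c) ->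
  \int[chain k n h]_w f w = c.
Proof.
elim: k n h => [|k IH] n h gh fc.
  rewrite integral_chain0; apply: fc; first exact/game_history_stay.
  exact: history_stay.
rewrite integral_chainS_region// (eq_integral (cst c)).
  by rewrite integral_cst// gamma_X// mule1.
move=> y /[1!inE] Xy; apply: IH; first exact/game_history_extend.
move=> w pw hw; apply: fc => //; rewrite -(prefix_history _ (leqnSn n)) hw.
rewrite -[RHS](history_stay_extend Omega eps0 x0 h y).
by rewrite -[in LHS](history_stay Omega eps0 x0 (extend h y)) prefix_history.
Qed.

End ChainIntegral.

Definition stopped_by n : set W := path `&` history n @^-1` S.

Lemma measurable_stopped_by n : measurable (stopped_by n).
Proof.
have mh : measurable_fun (path : set W) (@history R N n).
  exact: measurable_history.
apply: mh; [exact: measurable_path|exact: mS].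
Qed.

Lemma history_extend n (w : nat -> E) :
  history n.+1 w = extend (history n w) (w n.+1).
Proof.
apply: eq_from_tnth => i; rewrite tnth_mktuple.
have [ni|ni] := ltnP i n.+1.
  rewrite (_ : i = widen_ord (leqnSn _) (Ordinal ni)); last exact: val_inj.
  by rewrite extend_tnth tnth_mktuple.
rewrite (_ : i = ord_max) -/(hlast _) ?hlast_extend//.
by apply/val_inj/eqP; rewrite /= eqn_leq ni andbT -ltnS ltn_ord.
Qed.

Lemma nondecreasing_stopped_by : nondecreasing_seq stopped_by.
Proof.
apply/nondecreasing_seqP => n; apply/subsetPset => w [pw Sw]; split => //=.
rewrite history_extend; exact: S_extend.
Qed.

(** If [f] vanishes unless the path has stopped after [k] moves, one more move is
    immaterial: the paths that count no longer move. *)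
Lemma chain_absorbed (f : W -> \bar R) k n (h : n.+1.-tuple E) :
  (forall w, 0 <= f w) -> measurable_fun setT f ->
  (forall w, ~ stopped_by (n + k) w -> f w = 0) ->
  \int[chain k.+1 n h]_w f w = \int[chain k n h]_w f w.
Proof.
move=> f0 mf; elim: k n h => [|k IH] n h fS.
  have [Sh|nSh] := pselect (S h); first by rewrite !chain_stopped.
  rewrite integral_chainS// integral_chain0// fS; last first.
    by rewrite addn0 => -[_ /=]; rewrite history_stay.
  rewrite integral0_eq// => y _; rewrite integral_chain0// fS// addn0 => -[_ /=].
  by rewrite history_stay_extend.
rewrite integral_chainS// [RHS]integral_chainS//; apply: eq_integral => y _.
by apply: IH => w; rewrite addSnnS; exact: fS.
Qed.

Definition first_stop_at := seqD stopped_by.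

Lemma measurable_first_stop_at n : measurable (first_stop_at n).
Proof.
rewrite /first_stop_at; case: n => [|n] /=; first exact: measurable_stopped_by.
by apply: measurableD; exact: measurable_stopped_by.
Qed.

(** A path that stops at step [k] for the first time is final after [k] moves.
    The law of the stopped game is therefore the sum over [k] of the part of the
    law [chain k] that such paths carry. *)
Definition absorbed_law : {measure set W -> \bar R} :=
  mseries (fun k => mrestr (chain k 0 start) (measurable_first_stop_at k)) 0.

Section LawIntegral.
Variable f : W -> \bar R.
Hypothesis f0 : forall w, 0 <= f w.
Hypothesis mf : measurable_fun setT f.

Let mfD (D : set W) : measurable D -> measurable_fun setT (f \_ D).
Proof. by move=> mD; apply/(measurable_restrictT f mD); apply: measurable_funTS. Qed.

(** The sum telescopes because each of its terms may be computed with any later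
    number of moves, by [chain_absorbed]. *)
Lemma first_stop_sum m :
  \sum_(k < m.+1) \int[chain k 0 start]_(w in first_stop_at k) f w =
  \int[chain m 0 start]_(w in stopped_by m) f w.
Proof.
elim: m => [|m IH]; first by rewrite big_ord1.
have -> : stopped_by m.+1 = stopped_by m `|` first_stop_at m.+1.
  exact: setU_seqD nondecreasing_stopped_by _.
rewrite ge0_integral_setU//; first last.
- by rewrite disj_set_sym; apply/disj_setPS => w [[]].
- exact: measurable_funTS.
- exact: measurable_first_stop_at.
- exact: measurable_stopped_by.
rewrite big_ord_recr/= IH; congr (_ + _).
rewrite integral_mkcond [RHS]integral_mkcond; apply/esym/chain_absorbed.
- by move=> w; rewrite erestrict_ge0.
- by apply: mfD; exact: measurable_stopped_by.
- by move=> w nw; rewrite patchE memNset.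
Qed.

Lemma integral_absorbed_law :
  \int[chain m 0 start]_(w in stopped_by m) f w @[m --> \oo] -->
  \int[absorbed_law]_w f w.
Proof.
rewrite ge0_integral_measure_series//.
set a : nat -> \bar R := fun k => \int[mrestr (chain k 0 start)
  (measurable_first_stop_at k)]_w f w.
have := @is_cvg_nneseries _ a xpredT 0
  (fun n _ _ => @integral_ge0 _ _ _ _ _ _ (fun w _ => f0 w)).
rewrite -(cvg_shiftS (fun m => \sum_(0 <= k < m) a k)) => cu.
suff -> : (fun m => \int[chain m 0 start]_(w in stopped_by m) f w) =
  [sequence \sum_(0 <= k < n.+1) a k]_n by exact: cu.
apply/funext => m /=; rewrite big_mkord -first_stop_sum; apply: eq_bigr => k _.
by rewrite /a ge0_integral_mrestr.
Qed.

End LawIntegral.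

Lemma measurable_cylinder A n : borel_factors Omega eps0 A ->
  measurable (cylinder Omega eps0 x0 A n : set W).
Proof.
move=> bA; apply: (@filtration_measurable _ _ _ _ _ mX n).
by apply: sub_sigma_algebra; exists A.
Qed.

Lemma chain_indic k n (h : n.+1.-tuple E) A : measurable A ->
  chain k n h A = \int[chain k n h]_w (\1_A w)%:E.
Proof. by move=> mA; rewrite integral_indic// setIT. Qed.

Lemma measurable_EFin_indic (A : set W) : measurable A ->
  measurable_fun setT (fun w => (\1_A w)%:E : \bar R).
Proof. by move=> mA; apply/measurable_EFinP; exact: measurable_indic. Qed.

Lemma chainS_region k n (h : n.+1.-tuple E) A : measurable A -> game_history h ->
  chain k.+1 n h A = \int[gamma n h]_(y in X) chain k n.+1 (extend h y) A.
Proof.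
move=> mA gh; rewrite chainS; apply: ge0_integral_full => //.
- exact: gamma_region.
- exact: measurable_chain_extend.
Qed.

Section Survival.
Variables (V : E -> R) (rho : R).
Hypothesis V_ge1 : forall y, X y -> (1 <= V y)%R.
Hypothesis mV : measurable_fun setT V.
Hypothesis rho01 : (0 <= rho < 1)%R.
Hypothesis V_drift : forall n (h : n.+1.-tuple E), game_history h -> ~ S h ->
  \int[gamma n h]_(y in X) (V y)%:E <= (rho * V (hlast h))%:E.

(** A Lyapunov argument: [V >= 1] dominates the indicator of the running paths,
    and each move of a running path multiplies the mean of [V] by at most
    [rho]. *)
Lemma chain_survival k n (h : n.+1.-tuple E) : game_history h ->
  chain k n h (~` stopped_by (n + k)) <= (rho ^+ k * V (hlast h))%:E.
Proof.
have [rho0 rho1] := andP rho01.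
elim: k n h => [|k IH] n h gh.
  rewrite chain0 expr0 mul1r diracE lee_fin.
  apply: (@le_trans _ _ 1%R); first by case: (_ \in _).
  by apply: V_ge1; apply: gh.2.
have mC : measurable (~` stopped_by (n + k.+1)).
  by apply: measurableC; exact: measurable_stopped_by.
have [Sh|nSh] := pselect (S h).
  rewrite chain_indic// chain_stopped//; last exact: measurable_EFin_indic.
  rewrite indicE memNset; last first.
    have /subsetPset sub := nondecreasing_stopped_by (leq_addr k.+1 n).
    apply; apply: sub.
    by split; [exact/game_history_stay|rewrite /= history_stay].
  rewrite lee_fin mulr_ge0 ?exprn_ge0// (le_trans ler01)// V_ge1//; exact: gh.2.
rewrite chainS_region//.
apply: (@le_trans _ _ (\int[gamma n h]_(y in X) ((rho ^+ k)%:E * (V y)%:E))).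
  apply: ge0_le_integral => //.
  - apply: measurable_funTS; exact: measurable_chain_extend.
  - by apply: measurable_funTS; apply: measurable_funeM; exact/measurable_EFinP.
  - move=> y Xy; rewrite -addSnnS.
    apply: (le_trans (IH _ _ _)); first exact/game_history_extend.
    by rewrite hlast_extend EFinM.
rewrite ge0_integralZl_EFin//.
- apply: (@le_trans _ _ ((rho ^+ k)%:E * (rho * V (hlast h))%:E)).
    by apply: lee_wpmul2l; [rewrite lee_fin exprn_ge0|exact: V_drift].
  by rewrite -EFinM mulrA exprSr.
- by move=> y Xy; rewrite lee_fin (le_trans ler01)// V_ge1.
- by apply: measurable_funTS; exact/measurable_EFinP.
- by rewrite exprn_ge0.
Qed.

Lemma chain_survival_cvg0 : chain m 0 start (~` stopped_by m) @[m --> \oo] --> 0.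
Proof.
have [rho0 rho1] := andP rho01.
apply: (@squeeze_cvge _ _ _ _ (cst 0) _ (fun m => (rho ^+ m * V x0)%:E)).
- near=> m; rewrite measure_ge0/= -[m in ~` stopped_by m]add0n.
  by have := chain_survival m (game_history_start Xx0); rewrite hlast_start.
- exact: cvg_cst.
- apply: cvg_EFin; first by near=> m.
  rewrite -(mul0r (V x0)); apply: cvgMl; apply: cvg_expr.
  by rewrite ger0_norm.
Unshelve. all: by end_near. Qed.

End Survival.

Section Law.
Hypothesis survival0 :
  chain m 0 start (~` stopped_by m) @[m --> \oo] --> 0.

Lemma absorbed_lawE (A : set W) : measurable A ->
  chain m 0 start (A `&` stopped_by m) @[m --> \oo] --> absorbed_law A.
Proof.
move=> mA.
have i0 (w : W) : 0 <= (\1_A w)%:E :> \bar R by rewrite lee_fin.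
have := integral_absorbed_law i0 (measurable_EFin_indic mA).
rewrite integral_indic// setIT.
suff -> : (fun m => chain m 0 start (A `&` stopped_by m)) =
    (fun m => \int[chain m 0 start]_(w in stopped_by m) (\1_A w)%:E) by [].
apply/funext => m; rewrite integral_indic//; exact: measurable_stopped_by.
Qed.

(** The law [absorbed_law] keeps the paths of [chain m] that have stopped, and
    what it omits has vanishing mass. *)
Lemma absorbed_law_cst (A : set W) n c : measurable A ->
  (forall m, (n <= m)%N -> chain m 0 start A = c) -> absorbed_law A = c.
Proof.
move=> mA Ac.
have mS' m : measurable (stopped_by m) := measurable_stopped_by m.
have running0 : chain m 0 start (A `\` stopped_by m) @[m --> \oo] --> 0.
  apply: (@squeeze_cvge _ _ _ _ (cst 0) _
    (fun m => chain m 0 start (~` stopped_by m))); last 2 first.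
  - exact: cvg_cst.
  - exact: survival0.
  near=> m; rewrite measure_ge0/= le_measure// ?inE.
  - exact: measurableD.
  - exact: measurableC.
have lim_law : chain m 0 start A @[m --> \oo] --> absorbed_law A.
  rewrite -[absorbed_law A]adde0.
  rewrite (_ : (fun m => chain m 0 start A) =
      (fun m => chain m 0 start (A `&` stopped_by m)
        + chain m 0 start (A `\` stopped_by m))); last first.
    by apply/funext => m; rewrite (measureDI _ mA (mS' m)) addeC.
  apply: cvgeD; [by rewrite fin_num_adde_defl|exact: absorbed_lawE|exact: running0].
have lim_c : chain m 0 start A @[m --> \oo] --> c.
  apply: cvg_near_cst; near=> m; apply: Ac; near: m; exact: nbhs_infty_ge.
exact: cvg_unique lim_law lim_c.
Unshelve. all: by end_near. Qed.

Lemma absorbed_law_setT : absorbed_law setT = 1.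
Proof. by apply: (@absorbed_law_cst _ 0) => // m _; exact: prob_kernel. Qed.

Fixpoint iterated_gamma (A : nat -> set E) k n (h : n.+1.-tuple E) : \bar R :=
  if k is k'.+1 then
    \int[gamma n h]_(y in A n.+1) iterated_gamma A k' (extend h y)
  else 1.

Let stay_history n (w : nat -> E) i : (i <= n)%N -> stay (history n w) i = w i.
Proof.
move=> ni; have ni' : (i < n.+1)%N by [].
by rewrite -[i]/(nat_of_ord (Ordinal ni')) stay_small tnth_mktuple.
Qed.

Let stay_extend_small n (h : n.+1.-tuple E) y i : (i <= n)%N ->
  stay (extend h y) i = stay h i.
Proof.
move=> ni; rewrite -[in RHS](history_stay_extend Omega eps0 x0 h y).
by rewrite stay_history.
Qed.

Let stay_path n (h : n.+1.-tuple E) (w : nat -> E) i : (i <= n)%N ->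
  history n w = h -> stay h i = w i.
Proof. by move=> ni <-; exact: stay_history. Qed.

Let factors_hold (A : nat -> set E) n (h : n.+1.-tuple E) :=
  forall i, (1 <= i <= n)%N -> A i (stay h i).

Lemma chain_cylinder0 A k n (h : n.+1.-tuple E) r :
  borel_factors Omega eps0 A -> game_history h -> (n <= r)%N ->
  ~ factors_hold A h -> chain k n h (cylinder Omega eps0 x0 A r) = 0.
Proof.
move=> bA gh nr nA; have mC := measurable_cylinder r bA.
rewrite chain_indic//; apply: chain_const => //.
- exact: measurable_EFin_indic.
- move=> w pw hw; rewrite indicE memNset// => -[_ wA]; apply: nA => i /andP[i1 ni].
  by rewrite (stay_path ni hw); apply: wA; rewrite i1 (leq_trans ni).
Qed.

(** The cylinder tests the next [k] positions, which produces [k] integrals; the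
    [r] moves after them have total mass 1. *)
Lemma chain_cylinder A k r n (h : n.+1.-tuple E) :
  borel_factors Omega eps0 A -> game_history h -> factors_hold A h ->
  chain (k + r) n h (cylinder Omega eps0 x0 A (n + k)) = iterated_gamma A k h.
Proof.
move=> bA; elim: k n h => [|k IH] n h gh hA.
  have mC := measurable_cylinder (n + 0) bA.
  rewrite chain_indic//; apply: chain_const => //.
  - exact: measurable_EFin_indic.
  - move=> w pw hw; rewrite indicE mem_set//; split=> // i /andP[i1].
    by rewrite addn0 => ni; rewrite -(stay_path ni hw); apply: hA; rewrite i1.
rewrite addSn chainS_region//; last exact: measurable_cylinder.
rewrite /= -[in RHS](setIidr (bA n.+1).2) integral_mkcondr.
apply: eq_integral => y /[1!inE] Xy; rewrite -addSnnS.
have gy : game_history (extend h y) by exact/game_history_extend.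
have last_y : stay (extend h y) n.+1 = y by rewrite stay_large// hlast_extend.
rewrite patchE; have [Ay|nAy] := pselect (A n.+1 y).
  rewrite mem_set//; apply: IH => // i /andP[i1]; rewrite leq_eqVlt => /orP[/eqP ->|].
    by rewrite last_y.
  by rewrite ltnS => ni; rewrite stay_extend_small//; apply: hA; rewrite i1.
rewrite memNset//; apply: chain_cylinder0 => //; first exact: leq_addr.
by move=> /(_ n.+1); rewrite leqnn last_y => /(_ isT).
Qed.

Lemma absorbed_law_cylinder A n : borel_factors Omega eps0 A ->
  absorbed_law (cylinder Omega eps0 x0 A n) = iterated_gamma A n start.
Proof.
move=> bA; apply: (@absorbed_law_cst _ n); first exact: measurable_cylinder.
move=> m /subnKC <-; rewrite -[X in cylinder _ _ _ _ X]add0n chain_cylinder//.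
- exact: game_history_start.
- by move=> i /andP[i1]; rewrite leqNgt i1.
Qed.

End Law.

Section Submartingale.
Hypothesis survival0 :
  chain m 0 start (~` stopped_by m) @[m --> \oo] --> 0.
Variables (f : W -> R) (v : E -> R) (c eta : R).
Hypothesis f_ge0 : forall w, (0 <= f w)%R.
Hypothesis mf : measurable_fun setT f.
Hypothesis v_bound : forall y, (0 <= v y <= c)%R.
Hypothesis mv : measurable_fun setT v.
Hypothesis eta_ge0 : (0 <= eta)%R.
Hypothesis start_stop : S start -> (v x0 <= f (stay start))%R.
Hypothesis stop_ge : forall n (h : n.+1.-tuple E) y,
  game_history (extend h y) -> ~ S h -> S (extend h y) ->
  (v y <= f (stay (extend h y)))%R.
Hypothesis v_drift : forall n (h : n.+1.-tuple E), game_history h -> ~ S h ->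
  (v (hlast h))%:E <=
  \int[gamma n h]_(y in X) (v y)%:E + (eta / 2 ^+ n.+1)%:E.

(** What a path is worth when the game is interrupted after [m] moves: the reward
    if it has stopped, the potential [v] of its position otherwise. *)
Let value m : W -> \bar R := fun w =>
  ((EFin \o f) \_ (stopped_by m)) w
  + ((fun w : W => (v (w m))%:E) \_ (path `\` stopped_by m)) w.

Let value_ge0 m w : 0 <= value m w.
Proof.
apply: adde_ge0; apply: erestrict_ge0 => {}w _; rewrite lee_fin ?f_ge0//.
by have /andP[] := v_bound (w m).
Qed.

Let measurable_position m : measurable_fun (path : set W) (fun w : W => v (w m)).
Proof.
rewrite (_ : (fun w : W => v (w m)) =
    (v \o @hlast R N m) \o @history R N m).
  apply: measurableT_comp; last exact: measurable_history.
  by apply: measurableT_comp => //; exact: measurable_tnth.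
by apply/funext => w /=; rewrite hlast_history.
Qed.

Let mrunning m : measurable (path `\` stopped_by m : set W).
Proof.
apply: measurableD; first exact: measurable_path.
exact: measurable_stopped_by.
Qed.

Let measurable_running m :
  measurable_fun (path `\` stopped_by m : set W) (fun w : W => (v (w m))%:E : \bar R).
Proof.
apply/measurable_EFinP; apply: (@measurable_funS _ _ W _ (path : set W)).
- exact: measurable_path.
- by move=> w [].
- exact: measurable_position.
Qed.

Let measurable_value m : measurable_fun setT (value m).
Proof.
apply: emeasurable_funD.
  apply/(measurable_restrictT _ (measurable_stopped_by m)).
  by apply: measurable_funTS; exact/measurable_EFinP.
by apply/(measurable_restrictT _ (mrunning m)); exact: measurable_running.
Qed.

Let value_stopped n k (h : n.+1.-tuple E) : game_history h -> S h ->
  value (n + k) (stay h) = (f (stay h))%:E.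
Proof.
move=> gh Sh.
have Sw : stopped_by (n + k) (stay h).
  have /subsetPset := nondecreasing_stopped_by (leq_addr k n); apply.
  by split; [exact/game_history_stay|rewrite /= history_stay].
rewrite /value patchE mem_set// patchE memNset ?adde0//.
by move=> [].
Qed.

Let value_running n (h : n.+1.-tuple E) : game_history h -> ~ S h ->
  value n (stay h) = (v (hlast h))%:E.
Proof.
move=> gh nSh.
have nSw : ~ stopped_by n (stay h) by move=> [_ /=]; rewrite history_stay.
rewrite /value patchE memNset// add0e patchE mem_set ?stay_large//.
by split=> //; exact/game_history_stay.
Qed.

(** The errors [eta / 2 ^ j.+1] of the moves [j >= n] add up to [eta / 2 ^ n],
    which is why the induction on the number of moves closes. *)
Lemma chain_submartingale k n (h : n.+1.-tuple E) : game_history h -> ~ S h ->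
  (v (hlast h))%:E <=
  \int[chain k n h]_w value (n + k) w + (eta / 2 ^+ n)%:E.
Proof.
elim: k n h => [|k IH] n h gh nSh.
  rewrite integral_chain0// addn0 value_running// leeDl// lee_fin.
  by rewrite divr_ge0// exprn_ge0.
rewrite integral_chainS_region//.
set I := \int[_]_(_ in X) _.
suff Iv : \int[gamma n h]_(y in X) (v y)%:E <= I + (eta / 2 ^+ n.+1)%:E.
  apply: (le_trans (v_drift gh nSh)).
  apply: (@le_trans _ _ (I + (eta / 2 ^+ n.+1)%:E + (eta / 2 ^+ n.+1)%:E)).
    by rewrite leeD2r.
  rewrite -addeA -EFinD (_ : (_ + _)%R = (eta / 2 ^+ n)%R)//.
  have p2 : (2 ^+ n != 0 :> R)%R by rewrite expf_neq0.
  by rewrite exprS; field.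
have -> : I + (eta / 2 ^+ n.+1)%:E = \int[gamma n h]_(y in X)
    (\int[chain k n.+1 (extend h y)]_w value (n + k.+1) w
     + (eta / 2 ^+ n.+1)%:E).
  rewrite ge0_integralD//.
  - by rewrite integral_cst// gamma_X// mule1.
  - by move=> y _; exact: integral_ge0.
  - by apply: measurable_funTS; exact: measurable_integral_chain_extend.
  - by move=> y _; rewrite lee_fin divr_ge0// exprn_ge0.
apply: ge0_le_integral => //.
- by move=> y _; rewrite lee_fin; have /andP[] := v_bound y.
- by apply: measurable_funTS; exact/measurable_EFinP.
- by apply: emeasurable_funD => //; apply: measurable_funTS;
    exact: measurable_integral_chain_extend.
- move=> y Xy; have gy : game_history (extend h y) by exact/game_history_extend.
  rewrite -addSnnS; have [Sy|nSy] := pselect (S (extend h y)).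
    rewrite chain_stopped// value_stopped// -EFinD lee_fin.
    rewrite (le_trans (stop_ge gy nSh Sy))// lerDl divr_ge0// exprn_ge0//.
  by have := IH _ _ gy nSy; rewrite hlast_extend.
Qed.

(** In the limit the paths that are still running are lost; they carry vanishing
    mass and [v <= c] on them. *)
Lemma absorbed_law_submartingale :
  (v x0)%:E <= \int[absorbed_law]_w (f w)%:E + eta%:E.
Proof.
have f0 w : 0 <= (f w)%:E by rewrite lee_fin.
have mf' : measurable_fun setT (EFin \o f) by exact/measurable_EFinP.
have lim_f := integral_absorbed_law f0 mf'.
have c0 : (0 <= c)%R by have /andP[/le_trans h /h] := v_bound 0.
have lim : \int[chain m 0 start]_(w in stopped_by m) (f w)%:E
    + c%:E * chain m 0 start (~` stopped_by m) + eta%:E @[m --> \oo] -->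
    \int[absorbed_law]_w (f w)%:E + c%:E * 0 + eta%:E.
  have int_ge0 : 0 <= \int[absorbed_law]_w (f w)%:E by exact: integral_ge0.
  apply: cvgeD; [by rewrite fin_num_adde_defl|apply: cvgeD|exact: cvg_cst].
  - by rewrite mule0 fin_num_adde_defl.
  - exact: lim_f.
  - exact: cvgeMl.
rewrite -[X in _ <= X + _]adde0 -(mule0 c%:E).
rewrite -(cvg_lim _ lim)//; apply: lime_ge; first by apply/cvg_ex; eexists; exact: lim.
near=> m.
have gs := game_history_start Xx0.
have : (v x0)%:E <= \int[chain m 0 start]_w value m w + eta%:E.
  have [Ss|nSs] := pselect (S start).
    rewrite chain_stopped// -[X in value X]add0n value_stopped// -EFinD lee_fin.
    by rewrite (le_trans (start_stop Ss))// lerDl.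
  have := chain_submartingale m gs nSs.
  by rewrite hlast_start expr0 divr1 add0n.
move=> /le_trans; apply; rewrite leeD2r//.
rewrite ge0_integralD//; last 4 first.
- by move=> w _; apply: erestrict_ge0 => {}w _; exact: f0.
- apply/(measurable_restrictT _ (measurable_stopped_by m)).
  exact: measurable_funTS.
- move=> w _; apply: erestrict_ge0 => {}w _; rewrite lee_fin.
  by have /andP[] := v_bound (w m).
- by apply/(measurable_restrictT _ (mrunning m)); exact: measurable_running.
rewrite -!integral_mkcond leeD//.
apply: (@le_trans _ _ (\int[chain m 0 start]_(w in path `\` stopped_by m) c%:E)).
  apply: ge0_le_integral => //.
  - by move=> w _; rewrite lee_fin; have /andP[] := v_bound (w m).
  - by move=> w _; rewrite lee_fin; have /andP[] := v_bound (w m).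
rewrite integral_cst// lee_wpmul2l// le_measure// ?inE//.
- by apply: measurableC; exact: measurable_stopped_by.
Unshelve. all: by end_near. Qed.

End Submartingale.

End AbsorbedChain.

Local Close Scope ereal_scope.

(** * Uniqueness of laws on the path space *)

Section ProbabilityPackage.
Context d (T : measurableType d) (R : realType) (m : {measure set T -> \bar R}).
Hypothesis m1 : m [set: T] = 1%E.

(** As for [sigma_finite_copy], the proof carries the structure. *)
Definition probability_copy (_ : m [set: T] = 1%E) : set T -> \bar R := m.

HB.instance Definition _ := Measure.on (probability_copy m1).
HB.instance Definition _ := @Measure_isProbability.Build d T R
  (probability_copy m1) m1.

Definition probability_pack : probability T R := probability_copy m1.

End ProbabilityPackage.

Section GameLawUnique.
Context {R : realType} {N : nat} (Omega : set 'rV[R]_N) (eps0 : R).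
Context (x0 : 'rV[R]_N).
Local Notation E := 'rV[R]_N.
Local Notation X := (region Omega eps0).
Local Notation path := (path_space Omega eps0 x0).
Local Notation W := (path_type Omega eps0 x0).
Hypothesis mX : measurable X.

Lemma cylinderI A B m n : borel_factors Omega eps0 A -> borel_factors Omega eps0 B ->
  exists2 C, borel_factors Omega eps0 C &
    cylinder Omega eps0 x0 A m `&` cylinder Omega eps0 x0 B n =
    cylinder Omega eps0 x0 C (maxn m n).
Proof.
move=> bA bB.
exists (fun i => (if (i <= m)%N then A i else X) `&` (if (i <= n)%N then B i else X)).
  move=> i; split.
    by apply: measurableI; case: ifP => _ //; [exact: (bA i).1|exact: (bB i).1].
  by move=> x [+ _]; case: ifP => _ //; exact: (bA i).2.
apply/seteqP; split=> [w [[pw wA] [_ wB]]|w [pw wC]].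
  have wX i : (1 <= i)%N -> X (w i) by case: i => // i _; case: pw.
  split=> // i /andP[i1 _]; split; case: ifP => im; try exact: wX.
  - by apply: wA; rewrite i1.
  - by apply: wB; rewrite i1.
split; split=> // i /andP[i1 im].
  by have := wC i; rewrite i1 leq_max im => /(_ isT)[].
by have := wC i; rewrite i1 leq_max im orbT => /(_ isT)[].
Qed.

(** Cylinders are stable under intersection and generate the sigma-algebra, once
    the whole type is added to them: the functions that are not paths form an
    atom, on which the total mass decides. *)
Lemma path_law_unique (P Q : {measure set W -> \bar R}) :
  P setT = 1%E -> Q setT = 1%E ->
  (forall A n, borel_factors Omega eps0 A -> (1 <= n)%N ->
    P (cylinder Omega eps0 x0 A n) = Q (cylinder Omega eps0 x0 A n)) ->
  forall S, measurable S -> P S = Q S.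
Proof.
move=> P1 Q1 PQ S mS.
pose G : set (set W) := [set V | V = setT \/ exists A n,
  [/\ borel_factors Omega eps0 A, (1 <= n)%N & V = cylinder Omega eps0 x0 A n]].
have Gm : G `<=` measurable.
  move=> V [->|[A [n [bA n1 ->]]]]; first exact: measurableT.
  exact: measurable_cylinder.
apply: (g_sigma_algebra_measure_unique G Gm (fun _ : nat => setT)) => //.
- by move=> _; left.
- by rewrite bigcup_const//; exists 0%N.
- move=> U V [->|[A [m [bA m1 ->]]]]; first by rewrite setTI.
  move=> [->|[B [n [bB n1 ->]]]]; first by rewrite setIT; right; exists A, m.
  right; have [C bC ->] := cylinderI m n bA bB; exists C, (maxn m n).
  by split=> //; rewrite leq_max m1.
- by move=> V [->|[A [n [bA n1 ->]]]]; [rewrite P1 Q1|exact: PQ].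
- by move=> _; rewrite P1 ltry.
have sG : sigma_algebra setT <<s G >> by exact: smallest_sigma_algebra.
have [G0 GD GU] := sG.
have Gcyl A n : borel_factors Omega eps0 A -> (1 <= n)%N ->
    <<s G >> (cylinder Omega eps0 x0 A n).
  by move=> bA n1; apply: sub_sigma_algebra; right; exists A, n.
have GI U V : <<s G >> U -> <<s G >> V -> <<s G >> (U `&` V).
  exact: (@measurableI _ (g_sigma_algebraType G)).
have Gpath : <<s G >> path.
  rewrite (_ : path = cylinder Omega eps0 x0 (fun=> X) 1).
    by apply: Gcyl => // i; split.
  by apply/seteqP; split=> w; [move=> pw; split=> // -[|i] // _; case: pw|case].
move: S mS; apply: smallest_sub => //.
move=> S [n n1 FS].
suff : <<s path, [set cylinder Omega eps0 x0 A n | A in borel_factors Omega eps0] >> `<=`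
   [set U | <<s G >> U /\ U `<=` path] by move=> /(_ _ FS)[].
apply: smallest_sub.
  split.
  - by split.
  - move=> U [GUU Up]; split; last by move=> w [].
    by rewrite setDE; apply: GI => //; rewrite -setTD; exact: GD.
  - move=> F FG; split; first by apply: GU => i; exact: (FG i).1.
    by apply: bigcup_sub => i _; exact: (FG i).2.
by move=> _ [A bA <-]; split; [exact: Gcyl|move=> w []].
Qed.

End GameLawUnique.

(** * The transition kernel of the game *)

Section BallVolume.
Context {R : realType} {N : nat} (mu : {sigma_finite_measure set 'rV[R]_N -> \bar R}).
Hypothesis mu_box : forall z r, 0 <= r -> mu (box z r) = ((r *+ 2) ^+ N)%:E.
Context (eps : R) (eps_gt0 : 0 < eps).
Local Notation E := 'rV[R]_N.

Definition volume (x : E) : R := fine (mu (eball x eps)).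

Lemma mu_eball_le (x : E) : (mu (eball x eps) <= ((eps *+ 2) ^+ N)%:E)%E.
Proof.
rewrite -(mu_box x (ltW eps_gt0)); apply: le_measure; rewrite ?inE.
- exact: measurable_eball.
- exact: measurable_box.
- exact: eball_sub_box.
Qed.

Lemma mu_eballE (x : E) : mu (eball x eps) = (volume x)%:E.
Proof.
rewrite /volume fineK// ge0_fin_numE; last exact: measure_ge0.
exact: le_lt_trans (mu_eball_le x) (ltry _).
Qed.

Lemma volume_le (x : E) : volume x <= (eps *+ 2) ^+ N.
Proof. by rewrite -lee_fin -mu_eballE mu_eball_le. Qed.

Lemma volume_ge (x z : E) s : 0 <= s -> box z s `<=` eball x eps ->
  (s *+ 2) ^+ N <= volume x.
Proof.
move=> s0 zx; rewrite -lee_fin -mu_eballE -(mu_box z s0).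
apply: le_measure; rewrite ?inE//.
- exact: measurable_box.
- exact: measurable_eball.
Qed.

Lemma volume_gt0 (x : E) : 0 < volume x.
Proof.
have N1 : 0 < N.+1%:R :> R by rewrite ltr0n.
have s0 : 0 < eps / N.+1%:R by rewrite divr_gt0.
have sub : box x (eps / N.+1%:R) `<=` eball x eps.
  apply: box_sub_eball; first exact: ltW.
  by rewrite mulrCA gtr_pMr// ltr_pdivrMr// mul1r ltr_nat.
apply: lt_le_trans (volume_ge (ltW s0) sub).
by rewrite exprn_gt0// mulrn_wgt0.
Qed.

(** The value at [x] is the measure of a section of a measurable subset of the
    product, which is where sigma-finiteness enters. *)
Lemma measurable_mu_eball (U : set E) : measurable U ->
  measurable_fun [set: E] (fun x => mu (U `&` eball x eps)).
Proof.
move=> mU.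
pose D : set (E * E) := [set p | U p.2 /\ enorm (p.2 - p.1) < eps].
rewrite (_ : (fun x => _) = mu \o xsection D).
  apply: measurable_fun_xsection; apply: measurableI.
    rewrite -[X in measurable X]setTI.
    exact: (@measurable_snd _ _ E E measurableT _ mU).
  have mf : measurable_fun [set: E * E] (fun p => enorm (p.2 - p.1)).
    apply: (measurableT_comp measurable_enorm).
    by apply: measurable_subr; [exact: measurable_snd|exact: measurable_fst].
  rewrite [X in measurable X](_ : _ = (fun p : E * E => enorm (p.2 - p.1)) @^-1` `]-oo, eps[).
    by rewrite -[X in measurable X]setTI; exact: mf.
  by apply/seteqP; split=> p /=; rewrite in_itv.
apply/funext => x /=; congr (mu _); apply/seteqP; split=> y.
  by move=> [Uy yx]; rewrite /xsection/= inE.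
by rewrite /xsection/= inE.
Qed.

Lemma measurable_volumeV : measurable_fun [set: E] (fun x => (volume x)^-1).
Proof.
(* volumes are positive, so inversion is a composition of measurable maps *)
rewrite (_ : (fun x => _) = (fun x => expR (- ln (volume x)))).
  apply: (measurableT_comp (@measurable_expR R)); apply: measurable_funN.
  apply: (measurableT_comp (@measurable_ln R)).
  have mv := measurable_mu_eball (measurableT : measurable [set: E]).
  rewrite (_ : volume = fine \o (fun x => mu (setT `&` eball x eps))).
    by apply: measurableT_comp => //; exact: measurable_fine.
  by apply/funext => x /=; rewrite setTI.
by apply/funext => x; rewrite expRN lnK// posrE volume_gt0.
Qed.

End BallVolume.

Section JumpKernel.
Context {R : realType} {N : nat} (mu : {sigma_finite_measure set 'rV[R]_N -> \bar R}).
Hypothesis mu_box : forall z r, 0 <= r -> mu (box z r) = ((r *+ 2) ^+ N)%:E.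
Context (eps : R) (eps_gt0 : 0 < eps).
Context (a b : {nonneg R}) (ab1 : a%:num + a%:num + b%:num = 1).
Local Notation E := 'rV[R]_N.
Local Notation volume := (volume mu eps).
Context d (H : measurableType d) (S : set H) (mS : measurable S).
Context (pos s1 s2 : H -> E).
Hypothesis mpos : measurable_fun [set: H] pos.
Hypothesis ms1 : measurable_fun [set: H] s1.
Hypothesis ms2 : measurable_fun [set: H] s2.

Let density_ge0 x : 0 <= b%:num / volume x.
Proof. by rewrite divr_ge0// ltW// volume_gt0. Qed.

Definition jump (h : H) : {measure set E -> \bar R} :=
  measure_add
    (measure_add (mscale a (\d_(s1 h))) (mscale a (\d_(s2 h))))
    (mscale (NngNum (density_ge0 (pos h))) (mrestr mu (measurable_eball (pos h) eps))).

Lemma jumpE h A : jump h A = (a%:num%:E * \d_(s1 h) A + a%:num%:E * \d_(s2 h) A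
  + (b%:num / volume (pos h))%:E * mu (A `&` eball (pos h) eps))%E.
Proof. by rewrite [LHS]measure_addE [X in (X + _)%E]measure_addE. Qed.

(** The transition of the game, for an arbitrary type [H] of histories: [S] is the
    set of stopped ones, [pos] the current position, [s1] and [s2] the choices of
    the players. *)
Definition stopped_jump (h : H) : {measure set E -> \bar R} :=
  if h \in S then \d_(pos h) : {measure set E -> \bar R} else jump h.

Let measurable_stopped_jump U : measurable U ->
  measurable_fun [set: H] (stopped_jump ^~ U).
Proof.
move=> mU.
rewrite (_ : stopped_jump ^~ U = (fun h => if h \in S then (\d_(pos h) U)%E else jump h U)).
  have md (f : H -> E) : measurable_fun [set: H] f ->
      measurable_fun [set: H] (fun h => \d_(f h) U : \bar R).
    move=> mf; apply/measurable_EFinP.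
    have m1 : measurable_fun [set: E] (\1_U : E -> R) by exact: measurable_indic.
    exact: (measurableT_comp m1 mf).
  apply: measurable_fun_ifT; [|exact: md|].
    apply: (measurable_fun_bool true); rewrite setTI.
    rewrite (_ : _ @^-1` _ = S)//.
    by apply/seteqP; split=> h /=; [exact: set_mem|exact: mem_set].
  rewrite [X in measurable_fun _ X](funext (fun h => jumpE h U)).
  apply: emeasurable_funD.
    by apply: emeasurable_funD; apply: measurable_funeM; exact: md.
  apply: emeasurable_funM.
    apply/measurable_EFinP; apply: measurable_funM; first exact: measurable_cst.
    have mV := measurable_volumeV mu_box eps_gt0.
    exact: (measurableT_comp mV mpos).
  exact: (measurableT_comp (measurable_mu_eball mu eps mU) mpos).
by apply/funext => h; rewrite /stopped_jump; case: ifP.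
Qed.

HB.instance Definition _ := isKernel.Build _ _ _ _ R stopped_jump
  measurable_stopped_jump.

Let stopped_jump_prob h : stopped_jump h [set: E] = 1%E.
Proof.
rewrite /stopped_jump; case: ifP => _; first exact: diracT.
have d1 (y : E) : (\d_y [set: E] = 1 :> \bar R)%E by exact: diracT.
rewrite jumpE !d1 !mule1 setTI (mu_eballE mu_box eps_gt0) -!EFinM -!EFinD.
by rewrite divfK ?ab1// gt_eqF// volume_gt0.
Qed.

HB.instance Definition _ := Kernel_isProbability.Build _ _ _ _ R
  stopped_jump stopped_jump_prob.

Definition jump_kernel : R.-pker H ~> E := stopped_jump.

Lemma integral_jump h (f : E -> \bar R) : (forall y, 0 <= f y)%E ->
  measurable_fun setT f -> h \notin S ->
  (\int[jump_kernel h]_y f y = a%:num%:E * f (s1 h) + a%:num%:E * f (s2 h)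
  + (b%:num / volume (pos h))%:E * \int[mu]_(y in eball (pos h) eps) f y)%E.
Proof.
move=> f0 mf hS; rewrite /jump_kernel /= /stopped_jump (negbTE hS) /jump.
rewrite !ge0_integral_measure_add// !ge0_integral_mscale//.
by rewrite !integral_dirac// !diracT !mul1e ge0_integral_mrestr.
Qed.

End JumpKernel.

(** * Stopping times *)

Section EntryTime.
Context {R : realType} {N : nat} (Omega : set 'rV[R]_N) (eps0 : R).
Context (x0 : 'rV[R]_N).
Local Notation E := 'rV[R]_N.
Local Notation X := (region Omega eps0).
Local Notation path := (path_space Omega eps0 x0).
Hypothesis mX : measurable X.

Definition entry_time (A : set E) : @time R N := fun w =>
  match pselect (exists n, w n \in A) with
  | left ex => Some (ex_minn ex)
  | right _ => None
  end.

Lemma by_entry_timeP A w n :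
  by_time (entry_time A w) n <-> exists2 k, (k <= n)%N & A (w k).
Proof.
rewrite /entry_time; case: pselect => [ex|nex]; last first.
  by split=> // -[k _ Ak]; exfalso; apply: nex; exists k; rewrite inE.
case: ex_minnP => m /set_mem Am min_m /=; split=> [mn|[k kn Ak]].
  by exists m.
by apply: leq_trans kn; apply: min_m; rewrite inE.
Qed.

Lemma entry_time_in A w n : entry_time A w = Some n -> A (w n).
Proof.
rewrite /entry_time; case: pselect => // ex [<-].
by case: ex_minnP => m /set_mem.
Qed.

Lemma entry_time_stopping A : measurable A ->
  is_stopping_time Omega eps0 x0 (entry_time A).
Proof.
move=> mA n; apply/(filtrationP x0 mX).
exists (\bigcup_(i in [set: 'I_n.+1]) [set h : n.+1.-tuple E | A (tnth h i)]).
  apply: fin_bigcup_measurable => [|i _]; first exact: finite_finset.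
  by rewrite -[X in measurable X]setTI; exact: measurable_tnth.
apply/seteqP; split=> w /=.
  move=> [pw /by_entry_timeP[k kn Ak]]; split=> //=.
  by exists (Ordinal (kn : (k < n.+1)%N)) => //=; rewrite tnth_mktuple.
move=> [pw [i _ /=]]; rewrite tnth_mktuple => Ai; split=> //.
by apply/by_entry_timeP; exists i => //; rewrite -ltnS.
Qed.

Lemma entry_time_le A w : collar Omega eps0 `<=` A ->
  time_le (entry_time A w) (exit_time Omega eps0 w).
Proof.
move=> cA; have := @entry_time_in (collar Omega eps0) w.
have -> : exit_time Omega eps0 w = entry_time (collar Omega eps0) w by [].
case: (entry_time _ w) => //= n /(_ n erefl) cn.
by apply/by_entry_timeP; exists n => //; exact: cA.
Qed.

End EntryTime.

Section StoppingTimes.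
Context {R : realType} {N : nat} (Omega : set 'rV[R]_N) (eps0 : R).
Context (x0 : 'rV[R]_N).
Local Notation E := 'rV[R]_N.
Local Notation X := (region Omega eps0).
Local Notation path := (path_space Omega eps0 x0).
Local Notation W := (path_type Omega eps0 x0).
Local Notation stay := (@stay R N Omega eps0 x0 _).
Local Notation game_history := (@game_history R N Omega eps0 x0 _).
Hypothesis Xx0 : X x0.
Hypothesis mX : measurable X.

Lemma by_time_mono t m n : (m <= n)%N -> by_time t m -> by_time t n.
Proof. by case: t => //= k mn /leq_trans; exact. Qed.

Lemma by_time_min s t n : by_time (time_min s t) n = by_time s n || by_time t n.
Proof. by case: s t => [k|] [l|] //=; rewrite ?orbF// geq_min. Qed.

Lemma stopping_time_min (s t : @time R N) :
  is_stopping_time Omega eps0 x0 s -> is_stopping_time Omega eps0 x0 t ->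
  is_stopping_time Omega eps0 x0 (min_time s t).
Proof.
move=> ss st n; apply/(filtrationP x0 mX).
have /(filtrationP x0 mX)[B mB eB] := ss n.
have /(filtrationP x0 mX)[C mC eC] := st n.
exists (B `|` C); first exact: measurableU.
rewrite preimage_setU setIUr -eB -eC; apply/seteqP; split=> w /=.
  by move=> [pw]; rewrite /min_time by_time_min => /orP[]; [left|right].
by rewrite /min_time by_time_min => -[[pw ->]|[pw ->]]; split=> //; rewrite orbT.
Qed.

Section OneTime.
Variable tau : @time R N.
Local Notation stopped n := (@stopped R N Omega eps0 x0 tau n).
Hypothesis tau_stop : is_stopping_time Omega eps0 x0 tau.
Hypothesis tau_exit : forall w, path w -> time_le (tau w) (exit_time Omega eps0 w).

(** Whether [tau <= n] is decided by the first [n] moves, so the existential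
    quantifier over the continuations of a history is harmless. *)
Lemma stoppedE n : exists2 B : set (n.+1.-tuple E), measurable B &
  stopped n = game_history `&` B /\
  (forall w, path w -> by_time (tau w) n <-> B (history n w)).
Proof.
have /(filtrationP x0 mX)[B mB eB] := @tau_stop n.
have BP w : path w -> by_time (tau w) n <-> B (history n w).
  move=> pw; split=> [tn|Bw].
    have : (path `&` history n @^-1` B) w by rewrite -eB.
    by case.
  have : [set w | path w /\ by_time (tau w) n] w by rewrite eB.
  by case.
exists B => //; split=> //; apply/seteqP; split=> h.
  by move=> [w [pw <- /BP]] => /(_ pw) Bw; split=> //; exact: game_history_path.
move=> [gh Bh]; exists (stay h).
have ph : path (stay h) by exact/game_history_stay.
by split; rewrite ?history_stay//; apply/(BP _ ph); rewrite history_stay.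
Qed.

Lemma stoppedP n w : path w -> stopped n (history n w) <-> by_time (tau w) n.
Proof.
move=> pw; have [B _ [-> ->//]] := stoppedE n.
by split=> [[]//|Bw]; split=> //; exact: game_history_path.
Qed.

Lemma stopped_stay n (h : n.+1.-tuple E) : game_history h ->
  stopped n h <-> by_time (tau (stay h)) n.
Proof.
move=> gh; rewrite -(@stoppedP n); last exact/game_history_stay.
by rewrite history_stay.
Qed.

Lemma measurable_stopped n : measurable (stopped n).
Proof.
have [B mB [-> _]] := stoppedE n; apply: measurableI => //.
exact: measurable_game_history.
Qed.

(** Tuples that are not game histories are counted as halted, so that the
    transition probabilities can be extended to all tuples. *)
Definition halted n : set (n.+1.-tuple E) := stopped n `|` ~` game_history.

Lemma measurable_halted n : measurable (@halted n).
Proof.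
apply: measurableU; first exact: measurable_stopped.
by apply: measurableC; exact: measurable_game_history.
Qed.

Lemma halted_stopped n (h : n.+1.-tuple E) : game_history h ->
  halted h <-> stopped n h.
Proof. by move=> gh; split=> [[]//|]; left. Qed.

Lemma halted_extend n (h : n.+1.-tuple E) y : halted h -> halted (extend h y).
Proof.
move=> hh; have [ge|] := pselect (game_history (extend h y)); last by right.
have [gh Xy] : game_history h /\ X y by exact/game_history_extend.
move: hh => /(halted_stopped gh)/(stopped_stay gh) th; left; apply/(stopped_stay ge).
apply: (by_time_mono (leqnSn n)); apply/stoppedP; first exact/game_history_stay.
by rewrite history_stay_extend; exact/(stopped_stay gh).
Qed.

Lemma running_domain n (h : n.+1.-tuple E) : game_history h ->
  ~ halted h -> Omega (hlast h).
Proof.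
move=> gh nh; have [ch|//] := gh.2 ord_max; exfalso; apply: nh; left.
apply/(stopped_stay gh).
have ph : path (stay h) by exact/game_history_stay.
have := tau_exit ph; have : by_time (exit_time Omega eps0 (stay h)) n.
  by apply/(by_entry_timeP (collar Omega eps0)); exists n => //; rewrite stay_large.
case: (exit_time _ _ _) => //= k kn; exact: by_time_mono.
Qed.

Lemma first_halted n (h : n.+1.-tuple E) y : game_history (extend h y) ->
  ~ halted h -> halted (extend h y) -> tau (stay (extend h y)) = Some n.+1.
Proof.
move=> ge nh /(halted_stopped ge)/(stopped_stay ge).
have [gh _] : game_history h /\ X y by exact/game_history_extend.
have pe : path (stay (extend h y)) by exact/game_history_stay.
have : ~ by_time (tau (stay (extend h y))) n.
  move=> /(stoppedP _ pe); rewrite history_stay_extend => sh; apply: nh.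
  by left.
case: (tau _) => //= k /negP; rewrite -ltnNge => nk kn; congr Some.
by apply/eqP; rewrite eqn_leq kn.
Qed.

End OneTime.
End StoppingTimes.

(** * The law of the game *)

Section Play.
Context {R : realType} {N : nat} (mu : {sigma_finite_measure set 'rV[R]_N -> \bar R}).
Hypothesis muE : (mu : set _ -> \bar R) = @lebesgueN R N.
Hypothesis mu_box : forall z r, 0 <= r -> mu (box z r) = ((r *+ 2) ^+ N)%:E.
Hypothesis N_gt0 : (0 < N)%N.
Context (Omega : set 'rV[R]_N) (eps0 eps alpha beta : R) (x0 : 'rV[R]_N).
Local Notation E := 'rV[R]_N.
Local Notation X := (region Omega eps0).
Local Notation path := (path_space Omega eps0 x0).
Local Notation W := (path_type Omega eps0 x0).
Local Notation stay := (@stay R N Omega eps0 x0 _).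
Local Notation game_history := (@game_history R N Omega eps0 x0 _).
Local Notation volume := (volume mu eps).
Hypothesis bO : bounded_set Omega.
Hypothesis Ox0 : Omega x0.
Hypothesis eps_range : 0 < eps < eps0.
Hypothesis alpha01 : 0 <= alpha < 1.
Hypothesis betaE : beta = 1 - alpha.

Let eps_gt0 : 0 < eps. Proof. by case/andP: eps_range. Qed.
Let eps0_gt0 : 0 < eps0. Proof. by case/andP: eps_range; exact: lt_trans. Qed.
Let Omega0 : Omega !=set0. Proof. by exists x0. Qed.
Let mX : measurable X. Proof. exact: measurable_region. Qed.
Let Xx0 : X x0. Proof. by right. Qed.

Let half_alpha_ge0 : 0 <= alpha / 2.
Proof. by case/andP: alpha01 => a0 _; rewrite divr_ge0. Qed.
Let beta_gt0 : 0 < beta.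
Proof. by case/andP: alpha01; rewrite betaE subr_gt0. Qed.
Let weights : (NngNum half_alpha_ge0)%:num + (NngNum half_alpha_ge0)%:num
  + (NngNum (ltW beta_gt0))%:num = 1.
Proof. by rewrite /= -splitr betaE subrKC. Qed.

Lemma eball_region x : Omega x -> eball x eps `<=` X.
Proof.
by apply: eball_sub_region => //; apply: ltW; case/andP: eps_range.
Qed.

Variables (sI sII : @strategy R N) (tau : @time R N).
Hypothesis sI_ok : is_strategy Omega eps0 eps sI.
Hypothesis sII_ok : is_strategy Omega eps0 eps sII.
Hypothesis tau_stop : is_stopping_time Omega eps0 x0 tau.
Hypothesis tau_exit : forall w, path w -> time_le (tau w) (exit_time Omega eps0 w).
Local Notation halted := (@halted R N Omega eps0 x0 tau).

(** Strategies are Borel on tuples of points of the region only; they are extended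
    by 0 to make kernels on all tuples. *)
Let move_of (s : @strategy R N) n : n.+1.-tuple E -> E := (s n) \_ game_history.

Let measurable_move s n : is_strategy Omega eps0 eps s ->
  measurable_fun setT (@move_of s n).
Proof.
move=> s_ok; have mg : measurable (game_history : set (n.+1.-tuple E)).
  exact: measurable_game_history.
apply/(measurable_restrictT _ mg).
apply: (@measurable_funS _ _ _ _ (@history_space R N Omega eps0 n)).
- exact: measurable_history_space.
- by move=> h [].
- by have [] := s_ok n.
Qed.

Let move_ofE s n (h : n.+1.-tuple E) : game_history h -> move_of s h = s n h.
Proof. by move=> gh; rewrite /move_of patchE mem_set. Qed.

Let measurable_hlast n : measurable_fun setT (@hlast R N n).
Proof. exact: measurable_tnth. Qed.

Definition play_kernel n : R.-pker (n.+1.-tuple E) ~> E :=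
  jump_kernel mu_box eps_gt0 weights (measurable_halted Xx0 mX tau_stop (n := n))
    (@measurable_hlast n) (@measurable_move sI n sI_ok) (@measurable_move sII n sII_ok).

Lemma play_kernel_halted n (h : n.+1.-tuple E) A : halted h -> measurable A ->
  play_kernel n h A = (\d_(hlast h) A)%E.
Proof.
by move=> hh mA; rewrite /play_kernel /jump_kernel /= /stopped_jump mem_set.
Qed.

Lemma play_kernel_running n (h : n.+1.-tuple E) A : ~ halted h ->
  game_history h -> play_kernel n h A =
  ((alpha / 2)%:E * \d_(sI h) A + (alpha / 2)%:E * \d_(sII h) A
  + (beta / volume (hlast h))%:E * mu (A `&` eball (hlast h) eps))%E.
Proof.
move=> nh gh; rewrite /play_kernel /jump_kernel /= /stopped_jump memNset//.
by rewrite jumpE !move_ofE.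
Qed.

Lemma play_kernel_region n (h : n.+1.-tuple E) : game_history h ->
  play_kernel n h (~` X) = 0%E.
Proof.
move=> gh; have [hh|nh] := pselect (halted h).
  rewrite play_kernel_halted//; last exact: measurableC.
  by rewrite diracE memNset// => /(_ (gh.2 ord_max)).
rewrite play_kernel_running// !diracE !memNset.
- rewrite setIC (_ : _ `&` _ = set0) ?measure0 ?mule0 ?adde0//.
  apply/disjoints_subset; rewrite setCK; apply: eball_region.
  exact: running_domain nh.
- by move=> /(_ (((sII_ok n).2 h gh.2).2)).
- by move=> /(_ (((sI_ok n).2 h gh.2).2)).
Qed.

Lemma transitionE n (h : n.+1.-tuple E) : game_history h ->
  @transition R N Omega eps0 eps alpha beta x0 sI sII tau n h =
  (play_kernel n h : set E -> \bar R).
Proof.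
move=> gh; apply/funext => B; rewrite /transition.
have [sh|nsh] := pselect (stopped Omega eps0 x0 tau h).
  rewrite mem_set//; apply/esym.
  by rewrite /play_kernel /jump_kernel /= /stopped_jump mem_set//; left.
rewrite memNset// play_kernel_running//; last by move=> /(halted_stopped _ gh).
congr (_ + _)%E; rewrite -muE (mu_eballE mu_box eps_gt0) inver.
by rewrite gt_eqF ?volume_gt0// muleCA muleC; congr (_ * _)%E.
Qed.

Lemma iterated_integralE A k n (h : n.+1.-tuple E) : borel_factors Omega eps0 A ->
  game_history h ->
  @iterated_integral R N Omega eps0 eps alpha beta x0 sI sII tau A k n h =
  iterated_gamma play_kernel A k h.
Proof.
move=> bA; elim: k n h => [//|k IH] n h gh /=.
rewrite transitionE//; apply: eq_integral => y /[1!inE] Ay.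
by apply: IH; apply/game_history_extend; split=> //; exact: (bA n.+1).2.
Qed.

Local Notation start := (start_history x0).
Local Notation play_chain := (chain Xx0 mX play_kernel).
Local Notation running m := (~` @stopped_by R N Omega eps0 x0 halted m).

Lemma integral_play n (h : n.+1.-tuple E) (f : E -> \bar R) :
  game_history h -> ~ halted h ->
  (forall y, 0 <= f y)%E -> measurable_fun setT f ->
  (\int[play_kernel n h]_(y in X) f y =
   (alpha / 2)%:E * f (sI h) + (alpha / 2)%:E * f (sII h)
   + (beta / volume (hlast h))%:E * \int[mu]_(y in eball (hlast h) eps) f y)%E.
Proof.
move=> gh nh f0 mf; rewrite -ge0_integral_full//; last exact: play_kernel_region.
by rewrite integral_jump ?move_ofE//; apply/negP; rewrite inE.
Qed.

Let i0 : 'I_N := Ordinal N_gt0.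

Lemma region_coord_bound : exists2 M : R, 0 < M &
  forall y, X y -> `|y ord0 i0| <= M.
Proof.
have [M [_ OM]] := bO.
exists (`|M| + 2 + eps0).
  by rewrite addr_gt0// ltr_wpDl.
have OM' x : Omega x -> `|x ord0 i0| <= `|M| + 2.
  move=> Ox; have xM : `|x| <= `|M| + 1.
    by apply: OM => //; rewrite (le_lt_trans (ler_norm _))// ltrDl.
  have : ball (0 : E) (`|M| + 2) x.
    rewrite -ball_normE /ball_ /= sub0r normrN (le_lt_trans xM)//.
    by rewrite ltrD2l ltr1n.
  by move=> /ball_rVP[_ /(_ i0)]; rewrite mxE sub0r normrN => /ltW.
move=> y; rewrite (region_ballE Omega0 eps0_gt0) => -[x Ox yx].
rewrite -(subrK (x ord0 i0) (y ord0 i0)) (le_trans (ler_normD _ _))// addrC.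
rewrite lerD// ?OM'//; have := enorm_coord (y - x) i0; rewrite !mxE => /le_trans.
by apply; exact: ltW.
Qed.

(** With a probability bounded below, the random part of a move raises the first
    coordinate by a fixed amount. Hence one move at least doubles the mean of
    [expR (lam * y_1)] if [lam] is large, whatever the players do. As this
    function is bounded on the region, [K] minus it is a Lyapunov function for
    [chain_survival]. *)
Lemma play_stops : play_chain m 0 start (running m) @[m --> \oo] --> 0%E.
Proof.
have [M M0 XM] := region_coord_bound.
have N0 : 0 < N%:R :> R by rewrite ltr0n.
(* The cube of half side [d] around [x + (2d, ..., 2d)] lies in the ball of
   radius [eps] around [x]; on it the first coordinate exceeds that of [x] by at
   least [d], and the move falls into it with probability at least [q]. Then
   [lam] makes [q * expR (lam * d) >= q * lam * d = 2]. *)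
pose d := eps / (4 * N%:R); have d0 : 0 < d by rewrite divr_gt0// mulr_gt0.
pose q := beta * ((d *+ 2) ^+ N / (eps *+ 2) ^+ N).
have q0 : 0 < q by rewrite mulr_gt0// divr_gt0// exprn_gt0// mulrn_wgt0.
pose lam := 2 / (q * d); have lam0 : 0 < lam by rewrite divr_gt0// mulr_gt0.
pose K := expR (lam * M) + 1.
have K1 : 1 <= K by rewrite lerDr expR_ge0.
have K0 : 0 < K by exact: lt_le_trans K1.
(* The maximum with 1 changes nothing on the region and bounds [V] below. *)
pose V (y : E) := Num.max 1 (K - expR (lam * y ord0 i0)).
have VX y : X y -> V y = K - expR (lam * y ord0 i0).
  move=> Xy; apply/max_r; rewrite lerBrDl lerD2r ler_expR ler_pM2l//.
  exact: le_trans (ler_norm _) (XM _ Xy).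
have VK y : V y <= K.
  by rewrite /V ge_max K1/= gerBl expR_ge0.
have V1 y : 1 <= V y by rewrite /V le_max lexx.
have V0 y : 0 <= V y by exact: le_trans ler01 (V1 y).
have mV : measurable_fun [set: E] V.
  apply: measurable_maxr; first exact: measurable_cst.
  apply: measurable_funB; first exact: measurable_cst.
  apply: (measurableT_comp (@measurable_expR R)).
  by apply: measurable_funM; [exact: measurable_cst|exact: measurable_coord].
(* [V] falls by at least [low], a lower bound of the exponential on the region,
   and this is at least the fraction [low / K] of [V] because [V <= K]. *)
pose low := expR (- (lam * M)).
have low0 : 0 < low by exact: expR_gt0.
have lowK : low <= K.
  apply: le_trans K1; rewrite -expR0 ler_expR oppr_le0.
  by rewrite mulr_ge0// ltW.
pose rho := 1 - low / K.
apply: (@chain_survival_cvg0 _ _ _ _ _ Xx0 mX play_kernel halted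
  (measurable_halted Xx0 mX tau_stop)
  (halted_extend Xx0 mX tau_stop)
  play_kernel_halted play_kernel_region V rho) => //.
- by rewrite subr_ge0 ler_pdivrMr// mul1r lowK/= gtrBl divr_gt0.
move=> n h gh nh; rewrite integral_play//; last exact/measurable_EFinP.
have Ox : Omega (hlast h) by exact: running_domain nh.
set x := hlast h in Ox *; set e := expR (lam * x ord0 i0).
have mB : measurable (eball x eps) by exact: measurable_eball.
pose z := x + \row_i (d *+ 2).
pose D := box z d; have mD : measurable D by exact: measurable_box.
have DB : D `<=` eball x eps.
  move=> y zy; apply: (@box_sub_eball _ _ x (3 * d)) => [||i].
  - by rewrite mulr_ge0// ltW.
  - rewrite (_ : N%:R * (3 * d) = 3 / 4 * eps); last by rewrite /d; field; rewrite gt_eqF.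
    by rewrite gtr_pMl// ltr_pdivrMr// mul1r ltr_nat.
  - have := zy i; rewrite /z !mxE !ltr_norml => /andP[]; lra.
pose t := expR (lam * (x ord0 i0 + d)).
have qt : 2 * e <= q * t.
  rewrite /t mulrDr expRD mulrCA -/e [leLHS]mulrC ler_pM2l ?expR_gt0//.
  apply: (@le_trans _ _ (q * (lam * d))).
    by rewrite /lam (_ : q * _ = 2)//; field; rewrite !gt_eqF.
  rewrite ler_pM2l//; apply: le_trans (expR_ge1Dx _); by rewrite lerDr.
have volD : mu D = ((d *+ 2) ^+ N)%:E by rewrite mu_box// ltW.
have IV_ge0 : (0 <= \int[mu]_(y in eball x eps) (V y)%:E)%E.
  by apply: integral_ge0 => y _; rewrite lee_fin.
have IV : (\int[mu]_(y in eball x eps) (V y)%:E + (t * (d *+ 2) ^+ N)%:E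
    <= (K * volume x)%:E)%E.
  rewrite EFinM -volD -{1}(setIidl DB) -[mu (D `&` _)]integral_indic//.
  rewrite -ge0_integralZl_EFin//; last 2 first.
  - by apply/measurable_EFinP; exact: measurable_indic.
  - exact: expR_ge0.
  rewrite -ge0_integralD//; last 4 first.
  - by move=> y _; rewrite lee_fin.
  - by apply/measurable_EFinP; exact: measurable_funTS.
  - by move=> y _; rewrite -EFinM lee_fin mulr_ge0// expR_ge0.
  - by apply: measurable_funeM; apply/measurable_EFinP; exact: measurable_indic.
  rewrite EFinM -(mu_eballE mu_box eps_gt0) -(integral_cst _ mB).
  apply: ge0_le_integral => //.
  - by move=> y _; rewrite -EFinM -EFinD lee_fin addr_ge0// mulr_ge0// expR_ge0.
  - apply: emeasurable_funD.
      by apply/measurable_EFinP; exact: measurable_funTS.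
    by apply: measurable_funeM; apply/measurable_EFinP; exact: measurable_indic.
  - move=> y By; rewrite -EFinM -EFinD lee_fin VX; last exact: (eball_region Ox).
    rewrite -lerBrDr lerD2l lerN2 indicE; have [Dy|nDy] := pselect (D y); last first.
      by rewrite memNset// mulr0 expR_ge0.
    rewrite mem_set// mulr1 ler_expR ler_pM2l//.
    have := Dy i0; rewrite /z !mxE ltr_norml => /andP[]; lra.
have IV_fin : (\int[mu]_(y in eball x eps) (V y)%:E)%E \is a fin_num.
  rewrite ge0_fin_numE//; apply: le_lt_trans (ltry (K * volume x)).
  apply: le_trans IV; rewrite leeDl// lee_fin mulr_ge0// ?expR_ge0//.
  by rewrite exprn_ge0// mulrn_wge0// ltW.
rewrite -(fineK IV_fin) -!EFinM -!EFinD lee_fin; move: IV.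
rewrite -(fineK IV_fin) -!EFinD lee_fin; move: (fine _) => I IV.
have vol0 : 0 < volume x by exact: volume_gt0.
have avg : beta / volume x * I <= beta * K - q * t.
  apply: (@le_trans _ _ (beta * K - beta * t * (d *+ 2) ^+ N / volume x)).
    rewrite (_ : _ - _ = beta / volume x * (K * volume x - t * (d *+ 2) ^+ N)).
      rewrite ler_pM2l ?divr_gt0//; lra.
    by field; rewrite gt_eqF.
  rewrite lerD2l lerN2 (_ : q * t = beta * t * (d *+ 2) ^+ N / (eps *+ 2) ^+ N).
    rewrite ler_pM2l; last first.
      by rewrite mulr_gt0 ?exprn_gt0 ?mulrn_wgt0// mulr_gt0// expR_gt0.
    by rewrite lef_pV2 ?posrE ?exprn_gt0 ?mulrn_wgt0//; exact: volume_le.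
  by rewrite /q; ring.
have moves : alpha / 2 * V (sI h) + alpha / 2 * V (sII h) <= alpha * K.
  rewrite -mulrDr (_ : alpha * K = alpha / 2 * (K + K)); last by field.
  by rewrite ler_wpM2l// lerD.
have Vx : V x = K - e by apply: VX; right.
have le_low : low <= e.
  rewrite ler_expR -mulrN ler_pM2l// lerNl; have := XM x (or_intror Ox).
  by rewrite ler_norml => /andP[]; rewrite lerNl.
have le_rho : V x - low <= rho * V x.
  rewrite /rho mulrBl mul1r lerD2l lerN2 mulrAC ler_pdivrMr//.
  by rewrite ler_pM2l.
apply: le_trans le_rho; apply: le_trans (lerD moves avg) _; rewrite Vx.
rewrite (_ : alpha * K + _ = K - q * t); last by rewrite betaE; ring.
lra.
Qed.

Definition play_law : {measure set W -> \bar R} :=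
  absorbed_law Xx0 mX play_kernel (measurable_halted Xx0 mX tau_stop).

Let game_law0 := @game_law R N Omega eps0 eps alpha beta x0 sI sII tau.

Lemma play_law_setT : play_law setT = 1%E.
Proof.
apply: absorbed_law_setT; last exact: play_stops.
- exact: (halted_extend Xx0 mX tau_stop).
- exact: play_kernel_halted.
Qed.

Lemma play_law_cylinder A n : borel_factors Omega eps0 A ->
  play_law (cylinder Omega eps0 x0 A n) =
  iterated_integral Omega eps0 eps alpha beta x0 sI sII tau A n start.
Proof.
move=> bA; rewrite iterated_integralE//; last exact: game_history_start.
apply: absorbed_law_cylinder => //; last exact: play_stops.
- exact: (halted_extend Xx0 mX tau_stop).
- exact: play_kernel_halted.
- exact: play_kernel_region.
Qed.

(** The law that is chosen in the definition of the game exists, since the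
    absorbed law qualifies, and is determined by its values on cylinders. *)
Lemma game_lawE S : measurable S -> game_law0 S = play_law S.
Proof.
move=> mS; apply: path_law_unique => //.
- exact: probability_setT.
- exact: play_law_setT.
have gl : is_game_law eps alpha beta sI sII tau game_law0.
  apply: (@getPex _ [set P | is_game_law eps alpha beta sI sII tau P]).
  exists (probability_pack play_law_setT) => A n bA n1.
  exact: play_law_cylinder.
by move=> A n bA n1; rewrite play_law_cylinder//; exact: gl.
Qed.

(** Optional stopping for the game itself: the drift hypothesis is the one of
    [absorbed_law_submartingale], with the integral against the transition written
    out as two choices of the players and an average over the ball. *)
Lemma play_bound (g : (nat -> E) -> R) (u : E -> R) (C eta : R) :
  measurable_fun (path : set W) g -> (forall w, path w -> `|g w| <= C) ->
  measurable_fun X u -> (forall y, X y -> `|u y| <= C) -> 0 <= eta ->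
  (forall n w, path w -> tau w = Some n -> u (w n) <= g w) ->
  (forall n (h : n.+1.-tuple E), game_history h -> ~ stopped Omega eps0 x0 tau h ->
    u (hlast h) <= alpha / 2 * u (sI h) + alpha / 2 * u (sII h)
      + beta / volume (hlast h) * fine (\int[mu]_(y in eball (hlast h) eps) (u y)%:E)
      + eta / 2 ^+ n.+1) ->
  ((u x0 - eta)%:E <= \int[game_law0]_(w in path) (g w)%:E)%E.
Proof.
move=> mg gC mu_ uC eta0 stop_le drift.
rewrite (eq_measure_integral play_law) => [|A mA _]; last exact: game_lawE.
have mpath : measurable (path : set W) by exact: measurable_path.
have C0 : 0 <= C by apply: le_trans (uC _ Xx0).
(* [absorbed_law_submartingale] is about nonnegative functions. *)
pose v : E -> R := (fun y => u y + C) \_ X.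
pose f : W -> R := (fun w => g w + C) \_ path.
have f_ge0 w : 0 <= f w.
  rewrite /f patchE; case: ifPn => // /[1!inE] pw.
  by have := gC w pw; rewrite ler_norml => /andP[]; lra.
have mf : measurable_fun setT f.
  apply/(measurable_restrictT _ mpath); apply: measurable_funD => //.
have v_bound y : 0 <= v y <= C + C.
  rewrite /v patchE; case: ifPn => [/[1!inE] Xy|_]; last by rewrite lexx addr_ge0.
  by have := uC y Xy; rewrite ler_norml => /andP[]; lra.
have mv : measurable_fun setT v.
  by apply/(measurable_restrictT _ mX); apply: measurable_funD.
have vX y : X y -> v y = u y + C by move=> Xy; rewrite /v patchE mem_set.
have fP w : path w -> f w = g w + C by move=> pw; rewrite /f patchE mem_set.
have start_stop : halted start -> v x0 <= f (stay start).
  have gs := game_history_start Xx0.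
  have ps : path (stay start) by exact/game_history_stay.
  move=> /(halted_stopped _ gs)/(stopped_stay Xx0 mX tau_stop gs) t0.
  rewrite vX// fP// lerD2r -{1}(hlast_start x0).
  rewrite -(stay_large Omega eps0 x0 start (leqnn 0)); apply: stop_le => //.
  by case: (tau _) t0 => [[|//]|].
have stop_ge n (h : n.+1.-tuple E) y : game_history (extend h y) -> ~ halted h ->
    halted (extend h y) -> v y <= f (stay (extend h y)).
  move=> ge nh he; have pe : path (stay (extend h y)) by exact/game_history_stay.
  have [_ Xy] : game_history h /\ X y by exact/game_history_extend.
  rewrite vX// fP// lerD2r; have := stop_le n.+1 _ pe.
  rewrite stay_large// hlast_extend; apply; exact: first_halted ge nh he.
have v_drift n (h : n.+1.-tuple E) : game_history h -> ~ halted h ->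
    ((v (hlast h))%:E <= \int[play_kernel n h]_(y in X) (v y)%:E
      + (eta / 2 ^+ n.+1)%:E)%E.
  move=> gh nh; have Ox : Omega (hlast h) by exact: running_domain nh.
  have BX := eball_region Ox; set x := hlast h in Ox BX *.
  have mB : measurable (eball x eps) by exact: measurable_eball.
  have B_fin : (mu (eball x eps) < +oo)%E by rewrite (mu_eballE mu_box eps_gt0) ltry.
  have iu : mu.-integrable (eball x eps) (EFin \o u).
    apply: measurable_bounded_integrable => //.
      exact: measurable_funS mu_.
    exists C; split; first exact: num_real.
    by move=> M CM y By; apply: le_trans (ltW CM); exact/uC/BX.
  rewrite integral_play//; last 2 first.
  - by move=> y; rewrite lee_fin; case/andP: (v_bound y).
  - exact/measurable_EFinP.
  have -> : (\int[mu]_(y in eball x eps) (v y)%:E =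
      (fine (\int[mu]_(y in eball x eps) (u y)%:E) + C * volume x)%:E)%E.
    rewrite EFinD fineK; last exact: integrable_fin_num iu.
    rewrite EFinM -(mu_eballE mu_box eps_gt0) -(integral_cst _ mB) -integralD_EFin//.
      by apply: eq_integral => y /[1!inE] By; rewrite vX//; exact: BX.
    apply: (@measurable_bounded_integrable _ _ _ _ (cst C)) => //.
    exact: bounded_cst.
  rewrite -!EFinM -!EFinD lee_fin !vX; last 3 first.
  - exact: ((sII_ok n).2 h gh.2).2.
  - exact: ((sI_ok n).2 h gh.2).2.
  - exact: gh.2.
  have vol0 : volume x != 0 by rewrite gt_eqF// volume_gt0.
  have := drift n h gh (fun sh => nh (or_introl sh)); rewrite -/x.
  move: (fine _) => I; rewrite (mulrDr (beta / _)).
  rewrite (_ : beta / volume x * (C * volume x) = beta * C); last by field.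
  rewrite betaE; lra.
have := absorbed_law_submartingale (@measurable_halted _ _ _ _ _ Xx0 mX tau tau_stop)
  (halted_extend Xx0 mX tau_stop) play_kernel_halted play_kernel_region play_stops
  f_ge0 mf v_bound mv eta0 start_stop stop_ge v_drift.
rewrite -/play_law vX//.
have ig : play_law.-integrable path (EFin \o g).
  apply: measurable_bounded_integrable => //.
    apply: (@le_lt_trans _ _ (play_law setT)); first by rewrite le_measure ?inE.
    by rewrite play_law_setT ltry.
  exists C; split; first exact: num_real.
  by move=> M CM w pw; apply: le_trans (ltW CM); exact: gC.
have -> : (\int[play_law]_w (f w)%:E = \int[play_law]_(w in path) (g w)%:E
    + C%:E * play_law path)%E.
  rewrite -(integral_cst _ mpath) -integralD_EFin//; last first.
    apply: (@measurable_bounded_integrable _ _ _ _ (cst C)) => //.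
      apply: (@le_lt_trans _ _ (play_law setT)); first by rewrite le_measure ?inE.
      by rewrite play_law_setT ltry.
    exact: bounded_cst.
  rewrite [RHS]integral_mkcond; apply: eq_integral => w _.
  by rewrite /f !patchE; case: ifP.
rewrite -(fineK (integrable_fin_num mpath ig)); move: (fine _) => I.
have le1 : (C%:E * play_law path <= C%:E)%E.
  rewrite -[leRHS]mule1 lee_wpmul2l// -play_law_setT le_measure ?inE//.
move=> /le_trans le_u; have := le_u _ (leeD2r _ (leeD2l _ le1)).
rewrite -!EFinD !lee_fin; lra.
Qed.

End Play.

(** * Borel choice of almost maximal points *)

Section Selection.
Context {R : realType} {N : nat}.
Local Notation E := 'rV[R]_N.
Context (X Omega : set E) (eps : R) (eps_gt0 : 0 < eps).
Hypothesis mOmega : measurable Omega.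
Hypothesis ball_X : forall x, Omega x -> eball x eps `<=` X.
Variables (u : E -> R) (C : R).
Hypothesis uC : forall y, X y -> `|u y| <= C.

Lemma eball_sym (x y : E) (r : R) : eball x r y <-> eball y r x.
Proof. by rewrite /eball /= enormC. Qed.

(** The centres of the balls on which [u] somewhere exceeds a given level form an
    open set, even though [u] is only Borel, and countably many of the balls that
    make it up already cover it. Letting the level run over the rationals, one
    finds countably many points that approximate the suprema of [u] over all
    balls; the first suitable one is a Borel function of the centre. *)
Lemma almost_maximal_selection (delta : R) : 0 < delta ->
  exists sel : E -> E, [/\ measurable_fun setT sel,
    forall x, X x -> (eball x eps `&` X) (sel x) &
    forall x y, Omega x -> eball x eps y -> u y <= u (sel x) + delta].
Proof.
move=> delta0.
pose above (r : R) : set E := [set y | X y /\ r < u y].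
have ball_open (y : E) : open (eball y eps) by exact: open_eball.
have mnear r : measurable (\bigcup_(y in above r) eball y eps).
  by apply: open_measurable_rV; exact: bigcup_open.
(* [F r k] enumerates enough points above the level [r]. *)
have /choice[F FP] : forall r : rat, exists f : nat -> E,
    above (ratr r) !=set0 -> (forall k, above (ratr r) (f k)) /\
      \bigcup_(y in above (ratr r)) eball y eps = \bigcup_k eball (f k) eps.
  move=> r; have [ar|nar] := pselect (above (ratr r) !=set0); last first.
    by exists (fun=> 0).
  by have [f fP] := lindelof ball_open ar; exists f.
pose point (n : nat) : E :=
  if @unpickle (rat * nat)%type n is Some rk then F rk.1 rk.2 else 0.
(* The last condition says that [u] does not exceed [r + delta] on the ball. *)
pose near_max (rk : rat * nat) : set E := [set x |
  [/\ Omega x, above (ratr rk.1) (F rk.1 rk.2), eball (F rk.1 rk.2) eps x &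
      ~ (\bigcup_(y in above (ratr rk.1 + delta)) eball y eps) x]].
pose good (n : nat) : set E :=
  if @unpickle (rat * nat)%type n is Some rk then near_max rk else set0.
have mgood n : measurable (good n).
  rewrite /good; case: (unpickle n) => [[r k]|]; last exact: measurable0.
  rewrite /near_max /=.
  have [ak|nak] := pselect (above (ratr r) (F r k)); last first.
    by rewrite (_ : mkset _ = set0)//; apply/seteqP; split=> // x [].
  rewrite (_ : mkset _ = Omega `&` eball (F r k) eps `&`
    ~` (\bigcup_(y in above (ratr r + delta)) eball y eps)).
    apply: measurableI; first by apply: measurableI => //; exact: measurable_eball.
    by apply: measurableC; exact: mnear.
  by apply/seteqP; split=> x [] //; move=> [].
have good_cover x : Omega x -> exists n, good n x.
  move=> Ox; pose B := eball x eps.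
  have Bx : B x by exact: eball_center.
  have supB : has_sup (u @` B).
    split; first by exists (u x), x.
    exists C => _ [y By <-]; apply: le_trans (ler_norm _) _.
    exact/uC/(ball_X Ox).
  have [_ [y By <-] yr] := sup_adherent (divr_gt0 delta0 (ltr0Sn R 1)) supB.
  have [|r] := @rat_in_itvoo R (sup (u @` B) - delta) (u y).
    by apply: le_lt_trans yr; rewrite lerD2l lerN2 ler_pdivrMr// ler_peMr ?ler1n// ltW.
  rewrite in_itv /= => /andP[dr ru].
  have ar : above (ratr r) y by split => //; exact: (ball_X Ox).
  have [Fa Fc] := FP r (ex_intro _ y ar).
  have : (\bigcup_(y in above (ratr r)) eball y eps) x.
    by exists y => //; apply/eball_sym.
  rewrite Fc => -[k _ xk]; exists (pickle (r, k)); rewrite /good pickleK.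
  split=> // -[y' [Xy' ry']] /eball_sym By'.
  have := ub_le_sup supB.2 (imageP u By'); lra.
have point_good n x : good n x -> [/\ X (point n), eball x eps (point n) &
    forall y, eball x eps y -> u y <= u (point n) + delta].
  rewrite /good /point; case: (unpickle n) => [[r k]|//] /= [Ox [XF rF] xF nx].
  split=> // [|y xy]; first exact/eball_sym.
  rewrite leNgt; apply/negP => lt_uy; apply: nx; exists y; last exact/eball_sym.
  split; first exact: (ball_X Ox).
  by apply: lt_trans lt_uy; rewrite ltrD2r.
pose sel (x : E) := match pselect (exists n, `[<good n x>]) with
  | left ex => point (ex_minn ex) | right _ => x end.
have selP x n : good n x -> exists2 m, good m x & sel x = point m.
  move=> gn; rewrite /sel; case: pselect => [ex|[]]; last by exists n; apply/asboolP.
  by case: ex_minnP => m /asboolP gm _; exists m.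
exists sel; split.
- rewrite -(setUv (\bigcup_n good n)); apply/measurable_funU.
  + by apply: bigcup_measurable => n _; exact: mgood.
  + by apply: measurableC; apply: bigcup_measurable => n _; exact: mgood.
  split; last first.
    apply: (@eq_measurable_fun _ _ _ _ _ id) => [x /[1!inE] nx|].
      rewrite /sel; case: pselect => // ex; exfalso.
      by case: ex => n /asboolP gn; apply: nx; exists n.
    exact: measurable_id.
  rewrite seqDU_bigcup_eq; apply/measurable_fun_bigcup.
    move=> n; apply: measurableD; first exact: mgood.
    by apply: bigsetU_measurable => i _; exact: mgood.
  move=> n; apply: (@eq_measurable_fun _ _ _ _ _ (cst (point n))) => [x|].
    rewrite inE => -[gn ngn]; rewrite /sel; case: pselect => [ex|[]]; last first.
      by exists n; apply/asboolP.
    case: ex_minnP => m /asboolP gm mn /=; congr point; apply/eqP.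
    rewrite eqn_leq mn ?andbT; last exact/asboolP.
    rewrite leqNgt; apply/negP => mltn; apply: ngn.
    by rewrite -bigcup_mkord; exists m.
  exact: measurable_cst.
- move=> x Xx; have [[n gn]|ng] := pselect (exists n, good n x).
    by have [m gm ->] := selP x n gn; have [] := point_good m x gm.
  rewrite /sel; case: pselect => [ex|_].
    by exfalso; case: ex => n /asboolP gn; apply: ng; exists n.
  by split=> //; exact: eball_center.
- move=> x y Ox xy; have [n gn] := good_cover x Ox.
  by have [m gm ->] := selP x n gn; have [_ _] := point_good m x gm; apply.
Qed.

End Selection.

(** * The payoff *)

Section Payoff.
Context {R : realType} {N : nat} (Omega : set 'rV[R]_N) (eps0 : R).
Context (x0 : 'rV[R]_N) (F Psi1 Psi2 : 'rV[R]_N -> R).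
Local Notation E := 'rV[R]_N.
Local Notation X := (region Omega eps0).
Local Notation collar := (collar Omega eps0).
Local Notation path := (path_space Omega eps0 x0).
Local Notation W := (path_type Omega eps0 x0).
Hypothesis Xx0 : X x0.
Hypothesis mX : measurable X.
Hypothesis mOmega : measurable Omega.
Hypothesis mcollar : measurable collar.
Hypothesis mF : measurable_fun collar F.
Hypothesis mPsi1 : measurable_fun setT Psi1.
Hypothesis mPsi2 : measurable_fun setT Psi2.
Variables (tI tII : @time R N).
Hypothesis tI_stop : is_stopping_time Omega eps0 x0 tI.
Hypothesis tII_stop : is_stopping_time Omega eps0 x0 tII.
Local Notation tmin := (min_time tI tII).
Local Notation g := (stopped_payoff Omega eps0 F Psi1 Psi2 x0 tI tII).
Local Notation first_stopped n := (@first_stopped R N Omega eps0 x0 tI tII n).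

Lemma first_stoppedP n w : path w -> first_stopped n (history n w) <->
  exists2 k, (k <= n)%N & by_time (tI w) k && ~~ by_time (tII w) k.
Proof.
move=> pw; have pE k : (k <= n)%N ->
    [tuple (history n w)`_i | i < k.+1] = history k w by exact: prefix_history.
split=> -[k kn].
  rewrite (pE k kn) => -[/(stoppedP Xx0 mX tI_stop _ pw) tk ntk].
  exists k => //; rewrite tk; apply/negP => t2; apply: ntk.
  exact/(stoppedP Xx0 mX tII_stop _ pw).
move=> /andP[tk /negP ntk]; exists k => //.
rewrite (pE k kn); split.
  exact/(stoppedP Xx0 mX tI_stop _ pw).
by move=> /(stoppedP Xx0 mX tII_stop _ pw).
Qed.

(** In [Omega], a tie between the players is settled by [Psi2]: only a strictly
    earlier stop of Player I is paid [Psi1]. *)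
Lemma payoff_cases n w : path w -> tmin w = Some n ->
  [/\ collar (w n) & g w = F (w n)] \/
  [/\ Omega (w n), tI w = Some n & g w = Psi1 (w n)] \/
  [/\ Omega (w n), tII w = Some n & g w = Psi2 (w n)].
Proof.
move=> pw tn; rewrite /stopped_payoff tn /payoff hlast_history.
have Xwn : X (w n) by case: n {tn} => [|n]; [rewrite pw.1|exact: pw.2].
have tI_ge k : by_time (tI w) k -> (n <= k)%N.
  move=> tk; have : by_time (tmin w) k by rewrite /min_time by_time_min tk.
  by rewrite tn.
have tII_ge k : by_time (tII w) k -> (n <= k)%N.
  move=> tk; have : by_time (tmin w) k by rewrite /min_time by_time_min tk orbT.
  by rewrite tn.
have exact_time t : (forall k, by_time t k -> (n <= k)%N) -> by_time t n -> t = Some n.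
  case: t => // m h mn; congr Some; apply/eqP; rewrite eqn_leq (h m) ?andbT//=.
have [cw|ncw] := pselect (collar (w n)); first by left; rewrite mem_set.
right; rewrite [w n \in collar]memNset//.
have Ow : Omega (w n) by case: Xwn.
rewrite [w n \in Omega]mem_set//=.
have [fs|nfs] := pselect (first_stopped n (history n w)).
  left; rewrite mem_set//; split=> //.
  have /(first_stoppedP _ pw)[k kn /andP[tk _]] := fs.
  by apply: exact_time => //; exact: by_time_mono tk.
right; rewrite memNset//; split=> //.
apply: exact_time => //; apply/negP => /negP ntII; apply: nfs.
apply/(first_stoppedP _ pw); exists n => //; rewrite ntII andbT.
have : by_time (tmin w) n by rewrite tn /=.
by rewrite /min_time by_time_min (negbTE ntII) orbF.
Qed.

Lemma measurable_first_stopped n : measurable (first_stopped n).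
Proof.
rewrite (_ : first_stopped n = \bigcup_(k in [set k | (k <= n)%N])
  (@history_prefix R N k n @^-1` (stopped Omega eps0 x0 tI (n := k) `\`
                          stopped Omega eps0 x0 tII (n := k)))).
  apply: bigcup_measurable => k _; rewrite -[X in measurable X]setTI.
  apply: measurable_prefix => //; apply: measurableD; exact: measurable_stopped.
by apply/seteqP; split=> h [k kn hk]; exists k.
Qed.

(** The paths are cut into the countably many events where the game stops at time
    [n] and the one where it never stops; on each of them the payoff depends on
    finitely many positions. *)
Lemma measurable_stopped_payoff : measurable_fun (path : set W) g.
Proof.
have mpath : measurable (path : set W) by exact: measurable_path.
have st := stopping_time_min mX tI_stop tII_stop.
have mby n : measurable ([set w | path w /\ by_time (tmin w) n] : set W).
  exact: (filtration_measurable mX (st n)).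
pose at_ n : set W := seqD (fun n => [set w | path w /\ by_time (tmin w) n]) n.
have mat n : measurable (at_ n).
  rewrite /at_; case: n => [|n] /=; first exact: mby.
  by apply: measurableD; exact: mby.
have atP n w : at_ n w -> path w /\ tmin w = Some n.
  rewrite /at_; case: n => [|n] /= [].
    by move=> pw; case: (tmin w) => // k; rewrite /= leqn0 => /eqP ->.
  move=> [pw tn] ntn; split=> //; move: tn ntn; case: (tmin w) => //= k kn nk.
  congr Some; apply/eqP; rewrite eqn_leq kn ltnNge; apply/negP => kn'.
  by apply: nk.
have atE n w : path w -> tmin w = Some n -> at_ n w.
  move=> pw tn; rewrite /at_; case: n tn => [|n] tn /=.
    by split=> //; rewrite tn.
  split; first by split=> //; rewrite tn /= leqnn.
  by move=> [_]; rewrite tn /= ltnn.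
have mpos n (D : set W) : measurable D -> D `<=` path ->
    measurable_fun D (fun w : W => w n).
  move=> mD Dp; apply: (@measurable_funS _ _ W _ (path : set W)) => //.
  rewrite (_ : (fun w : W => w n) = @hlast R N n \o @history R N n).
    apply: measurableT_comp; first exact: measurable_tnth.
    exact: measurable_history.
  by apply/funext => w /=; rewrite hlast_history.
have mset n (D : set W) A : measurable D -> D `<=` path -> measurable A ->
    measurable_fun D (fun w : W => w n \in A).
  move=> mD Dp mA; apply: (measurable_fun_bool true).
  rewrite (_ : _ `&` _ = D `&` (fun w : W => w n) @^-1` A).
    exact: (mpos n D mD Dp mD).
  apply/seteqP; split=> w [Dw /= wA]; split=> //; first exact: set_mem.
  exact: mem_set.
have -> : (path : set W) = (\bigcup_n at_ n) `|` (path `\` \bigcup_n at_ n).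
  by rewrite setDUK// => w [n _ /atP[]].
have mU : measurable (\bigcup_n at_ n) by exact: bigcup_measurable.
apply/measurable_funU => //; first exact: measurableD.
split; last first.
  apply: (@eq_measurable_fun _ _ W R _ (cst 0)) => [w|].
    rewrite inE => -[pw nw]; rewrite /stopped_payoff.
    move: (fun n => atE n w pw); case: (tmin w) => // n /(_ n erefl) wn.
    by exfalso; apply: nw; exists n.
  exact: measurable_cst.
apply/measurable_fun_bigcup => // n.
apply: (@eq_measurable_fun _ _ W R _ (fun w : W =>
    @payoff R N Omega eps0 F Psi1 Psi2 x0 tI tII n (history n w))) => [w|].
  by rewrite inE => /atP[_ tn]; rewrite /stopped_payoff tn.
have atp m : at_ m `<=` path by move=> w /atP[].
rewrite /payoff.
rewrite (_ : (fun w : W => _) = (fun w : W => if w n \in collar then F (w n) else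
   if (w n \in Omega) && (history n w \in first_stopped n) then Psi1 (w n)
   else Psi2 (w n))); last by apply/funext => w; rewrite hlast_history.
apply: measurable_fun_if => //.
- exact: mset.
- have -> : (fun w : W => F (w n)) = F \o (fun w : W => w n) by [].
  apply: (@measurable_comp _ _ _ _ _ _ collar) => //.
    by move=> _ [w [_ /=] /set_mem cw <-].
  apply: (mpos _ _); last by move=> w [/atp].
  have -> : at_ n `&` (fun w => w n \in collar) @^-1` [set true] =
     at_ n `&` (fun w : W => w n) @^-1` collar.
    apply/seteqP; split=> w [aw /= wc]; split=> //; first exact: set_mem.
    exact: mem_set.
  exact: (mpos n (at_ n) (mat n) (@atp n)).
set D := at_ n `&` _; have mD : measurable D.
  exact: (mset n (at_ n) collar (mat n) (@atp n)).
have Dp : D `<=` path by move=> w [/atp].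
apply: measurable_fun_if => //.
- apply: measurable_and; first exact: mset.
  apply: (measurable_fun_bool true).
  rewrite (_ : _ `&` _ = D `&` (path `&` @history R N n @^-1` first_stopped n)).
    apply: measurableI => //.
    have mh : measurable_fun (path : set W) (@history R N n) by exact: measurable_history.
    apply: mh => //; exact: measurable_first_stopped.
  apply/seteqP; split=> w [Dw] /=.
    by move=> /set_mem fs; split=> //; split=> //; exact: Dp.
  by move=> [_ fs]; split=> //; exact: mem_set.
- apply: measurable_funS (_ : measurable_fun D (fun w : W => Psi1 (w n))) => //.
  exact: (measurableT_comp mPsi1 (mpos n D mD Dp)).
- apply: measurable_funS (_ : measurable_fun D (fun w : W => Psi2 (w n))) => //.
  exact: (measurableT_comp mPsi2 (mpos n D mD Dp)).
Qed.

End Payoff.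

(** * The values of the game *)

Section Value.
Context {R : realType} {N : nat} (mu : {sigma_finite_measure set 'rV[R]_N -> \bar R}).
Hypothesis muE : (mu : set _ -> \bar R) = @lebesgueN R N.
Hypothesis mu_box : forall z r, 0 <= r -> mu (box z r) = ((r *+ 2) ^+ N)%:E.
Hypothesis N_gt0 : (0 < N)%N.
Context (Omega : set 'rV[R]_N) (eps0 eps alpha beta : R) (x0 : 'rV[R]_N).
Context (F Psi1 Psi2 u : 'rV[R]_N -> R) (C : R).
Local Notation E := 'rV[R]_N.
Local Notation X := (region Omega eps0).
Local Notation collar := (collar Omega eps0).
Local Notation path := (path_space Omega eps0 x0).
Local Notation W := (path_type Omega eps0 x0).
Local Notation game_history := (@game_history R N Omega eps0 x0 _).
Local Notation plays := (plays Omega eps0 eps x0).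
Local Notation payoff tI tII := (stopped_payoff Omega eps0 F Psi1 Psi2 x0 tI tII).
Local Notation expected :=
  (expected_payoff Omega eps0 eps alpha beta F Psi1 Psi2 x0).
Hypothesis oO : open Omega.
Hypothesis bO : bounded_set Omega.
Hypothesis Ox0 : Omega x0.
Hypothesis eps_range : 0 < eps < eps0.
Hypothesis alpha01 : 0 <= alpha < 1.
Hypothesis betaE : beta = 1 - alpha.
Hypothesis mF : measurable_fun collar F.
Hypothesis mPsi1 : measurable_fun setT Psi1.
Hypothesis mPsi2 : measurable_fun setT Psi2.
Hypothesis FC : forall x, collar x -> `|F x| <= C.
Hypothesis Psi1C : forall x, `|Psi1 x| <= C.
Hypothesis Psi2C : forall x, `|Psi2 x| <= C.
Hypothesis Psi12 : forall x, X x -> Psi1 x <= Psi2 x.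
Hypothesis u_sol : obstacle_solution Omega eps0 eps alpha beta F Psi1 Psi2 u.

Let eps_gt0 : 0 < eps. Proof. by case/andP: eps_range. Qed.
Let eps0_gt0 : 0 < eps0. Proof. by case/andP: eps_range; exact: lt_trans. Qed.
Let Omega0 : Omega !=set0. Proof. by exists x0. Qed.
Let mX : measurable X. Proof. exact: measurable_region. Qed.
Let Xx0 : X x0. Proof. by right. Qed.
Let mOmega : measurable Omega. Proof. exact: open_measurable_rV. Qed.
Let mcollar : measurable collar. Proof. exact: measurable_collar. Qed.
Let half_alpha_ge0 : 0 <= alpha / 2.
Proof. by case/andP: alpha01 => a0 _; rewrite divr_ge0. Qed.
Let half_alpha_le1 : alpha / 2 <= 1.
Proof. by case/andP: alpha01 => _ a1; rewrite ler_pdivrMr// mul1r ltW// (lt_trans a1)// ltr1n. Qed.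
Let ball_X x : Omega x -> eball x eps `<=` X.
Proof. move=> Ox; exact: (eball_region Ox0 eps_range Ox). Qed.

Let mu_ : measurable_fun X u. Proof. by case: u_sol. Qed.
Let u_collar x : collar x -> u x = F x. Proof. by case: u_sol => _ _; apply. Qed.
Let u_eq x : Omega x -> u x = Num.max (Psi1 x)
  (Num.min (Psi2 x) (mean_operator eps alpha beta u x)).
Proof. by case: u_sol => _ + _; apply. Qed.

Let Psi1_le_u x : Omega x -> Psi1 x <= u x.
Proof. by move=> Ox; rewrite u_eq// le_max lexx. Qed.

Let u_le_Psi2 x : Omega x -> u x <= Psi2 x.
Proof.
move=> Ox; rewrite u_eq// ge_max ge_min lexx andbT; apply: Psi12; by right.
Qed.

Let uC x : X x -> `|u x| <= C.
Proof.
move=> [cx|Ox]; first by rewrite u_collar// FC.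
have := Psi1C x; have := Psi2C x; rewrite !ler_norml => /andP[_ h2] /andP[h1 _].
by rewrite (le_trans h1 (Psi1_le_u Ox)) (le_trans (u_le_Psi2 Ox) h2).
Qed.

Let C_ge0 : 0 <= C. Proof. exact: le_trans (Psi1C 0). Qed.

Let payoff_le tI tII w : is_stopping_time Omega eps0 x0 tI ->
  is_stopping_time Omega eps0 x0 tII -> path w -> `|payoff tI tII w| <= C.
Proof.
move=> stI stII pw; have pc n := @payoff_cases R N Omega eps0 x0 F Psi1 Psi2
  Xx0 mX tI tII stI stII n w pw.
case tw : (min_time tI tII w) => [n|]; last by rewrite /stopped_payoff tw normr0.
by have [[cw ->]|[[_ _ ->]|[_ _ ->]]] := pc n tw; [exact: FC| |].
Qed.

Let move_to (sel : nat -> E -> E) : @strategy R N := fun n h => sel n (hlast h).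

Let move_to_strategy sel : (forall n, measurable_fun setT (sel n)) ->
  (forall n x, X x -> (eball x eps `&` X) (sel n x)) ->
  is_strategy Omega eps0 eps (move_to sel).
Proof.
move=> msel sel_in n; split; last first.
  by move=> h hX; exact: (sel_in n _ (hX ord_max)).
apply: measurable_funTS; rewrite /move_to.
apply: (measurableT_comp (msel n)); exact: measurable_tnth.
Qed.

Let entry_plays (A : set E) sel : measurable A -> collar `<=` A ->
  (forall n, measurable_fun setT (sel n)) ->
  (forall n x, X x -> (eball x eps `&` X) (sel n x)) ->
  plays (move_to sel, entry_time A).
Proof.
move=> mA cA msel sel_in; split=> /=.
- exact: move_to_strategy.
- exact: entry_time_stopping.
- by move=> w _; exact: entry_time_le.
Qed.

Let min_exit (p q : strategy * time) : plays p -> plays q ->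
  forall w, path w -> time_le (min_time p.2 q.2 w) (exit_time Omega eps0 w).
Proof.
move=> [_ _ p_exit] [_ _ q_exit] w pw; have := p_exit w pw.
case: (exit_time _ _ _) => //= n pn.
by rewrite /min_time by_time_min pn.
Qed.

Let min_stop (p q : strategy * time) : plays p -> plays q ->
  is_stopping_time Omega eps0 x0 (min_time p.2 q.2).
Proof. by move=> [_ ? _] [_ ? _]; exact: stopping_time_min. Qed.

Let running_not_in (p q : strategy * time) (A : set E) n (h : n.+1.-tuple E) :
  plays p -> plays q -> entry_time A = p.2 \/ entry_time A = q.2 ->
  game_history h -> ~ stopped Omega eps0 x0 (min_time p.2 q.2) h ->
  Omega (hlast h) /\ ~ A (hlast h).
Proof.
move=> pp pq eA gh nh; have st := min_stop pp pq; have ex := min_exit pp pq.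
split.
  apply: (running_domain Xx0 mX st ex gh) => -[//|]; exact.
move=> Ah; apply: nh; apply/(stopped_stay Xx0 mX st gh).
rewrite /min_time by_time_min; apply/orP.
by case: eA => <-; [left|right]; apply/by_entry_timeP; exists n => //; rewrite stay_large.
Qed.

(** Player I moves almost to a maximum of [u] and stops when [u] touches the lower
    obstacle. Before, [u > Psi1] forces [u] to be at most its mean operator, so
    that [u] is a submartingale up to the errors of the moves; at the end, [u] is
    at most the payoff. *)
Lemma playerI_guarantee eta : 0 < eta -> exists2 pI, plays pI &
  forall pII, plays pII -> ((u x0 - eta)%:E <= expected pI pII)%E.
Proof.
move=> eta0.
have /choice[sel selP] : forall n : nat, exists sel : E -> E,
    [/\ measurable_fun setT sel, forall x, X x -> (eball x eps `&` X) (sel x) &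
      forall x y, Omega x -> eball x eps y -> u y <= u (sel x) + eta / 2 ^+ n.+1].
  move=> n; apply: (almost_maximal_selection eps_gt0 mOmega ball_X uC).
  by rewrite divr_gt0// exprn_gt0.
pose A : set E := collar `|` (Omega `&` [set x | u x <= Psi1 x]).
have mA : measurable A.
  apply: measurableU => //.
  have -> : Omega `&` [set x | u x <= Psi1 x] =
      Omega `&` (fun x => u x - Psi1 x) @^-1` `]-oo, 0].
    by apply/seteqP; split=> x [Ox] /=; rewrite in_itv/= subr_le0.
  apply: measurable_funB => //; last exact: measurable_funTS.
  by apply: (measurable_funS mX) mu_ => x Ox; right.
have pI_ok : plays (move_to sel, entry_time A).
  apply: entry_plays => //.
  - by move=> x cx; left.
  - by move=> n; have [] := selP n.
  - by move=> n; have [] := selP n.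
exists (move_to sel, entry_time A) => // pII pII_ok.
have [sI_ok stI _] := pI_ok; have [sII_ok stII _] := pII_ok.
apply: (play_bound muE mu_box N_gt0 bO Ox0 eps_range alpha01 betaE sI_ok sII_ok
  (min_stop pI_ok pII_ok) (min_exit pI_ok pII_ok) (C := C)) => //.
- exact: measurable_stopped_payoff.
- by move=> w pw; exact: payoff_le.
- exact: ltW.
- move=> n w pw tw.
  have [[cw ->]|[[Ow tn ->]|[Ow _ ->]]] := payoff_cases F Psi1 Psi2 Xx0 mX stI stII pw tw.
  + by rewrite u_collar.
  + by have [[]//|[]] := entry_time_in tn.
  + exact: u_le_Psi2.
move=> n h gh nh.
have [Oh nAh] := running_not_in pI_ok pII_ok (or_introl erefl) gh nh.
set x := hlast h in Oh nAh *.
have le_mean : u x <= mean_operator eps alpha beta u x.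
  have : u x <= Num.max (Psi1 x) (Num.min (Psi2 x) (mean_operator eps alpha beta u x)).
    by rewrite -u_eq.
  rewrite le_max => /orP[le1|]; first by exfalso; apply: nAh; right.
  by rewrite le_min => /andP[].
apply: (le_trans le_mean); rewrite /mean_operator -muE -/(volume mu eps x).
set avg := beta / _ * _; set e := eta / 2 ^+ n.+1.
have Bx : (eball x eps) !=set0 by exists x; exact: eball_center.
have sup_le : sup (u @` eball x eps) <= u (move_to sel h) + e.
  apply: ge_sup; first by have [y By] := Bx; exists (u y), y.
  by move=> _ [y By <-]; have [_ _ sel_max] := selP n; exact: sel_max.
have inf_le : inf (u @` eball x eps) <= u (pII.1 n h).
  apply: ge_inf; last by exists (pII.1 n h) => //; exact: ((sII_ok n).2 h gh.2).1.
  exists (- C) => _ [y By <-]; have := uC (ball_X Oh By).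
  by rewrite ler_norml => /andP[].
have e0 : 0 <= e by rewrite divr_ge0 ?exprn_ge0// ltW.
have := ler_wpM2l half_alpha_ge0 sup_le; have := ler_wpM2l half_alpha_ge0 inf_le.
have := ler_wpM2r e0 half_alpha_le1; rewrite mul1r mulrDr.
by rewrite -/x; lra.
Qed.

(** The same argument for [- u], Player II stopping when [u] touches the upper
    obstacle; only the payoff rule is not symmetric in the players, and
    [payoff_cases] takes care of it. *)
Lemma playerII_guarantee eta : 0 < eta -> exists2 pII, plays pII &
  forall pI, plays pI -> (expected pI pII <= (u x0 + eta)%:E)%E.
Proof.
move=> eta0; pose v x := - u x.
have vC x : X x -> `|v x| <= C by rewrite normrN; exact: uC.
have mv : measurable_fun X v by exact: measurable_funN.
have /choice[sel selP] : forall n : nat, exists sel : E -> E,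
    [/\ measurable_fun setT sel, forall x, X x -> (eball x eps `&` X) (sel x) &
      forall x y, Omega x -> eball x eps y -> v y <= v (sel x) + eta / 2 ^+ n.+1].
  move=> n; apply: (almost_maximal_selection eps_gt0 mOmega ball_X vC).
  by rewrite divr_gt0// exprn_gt0.
pose A : set E := collar `|` (Omega `&` [set x | Psi2 x <= u x]).
have mA : measurable A.
  apply: measurableU => //.
  have -> : Omega `&` [set x | Psi2 x <= u x] =
      Omega `&` (fun x => Psi2 x - u x) @^-1` `]-oo, 0].
    by apply/seteqP; split=> x [Ox] /=; rewrite in_itv/= subr_le0.
  apply: measurable_funB => //; first exact: measurable_funTS.
  by apply: (measurable_funS mX) mu_ => x Ox; right.
have pII_ok : plays (move_to sel, entry_time A).
  apply: entry_plays => //.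
  - by move=> x cx; left.
  - by move=> n; have [] := selP n.
  - by move=> n; have [] := selP n.
exists (move_to sel, entry_time A) => // pI pI_ok.
have [sI_ok stI _] := pI_ok; have [sII_ok stII _] := pII_ok.
have mpay : measurable_fun (path : set W) (payoff pI.2 (entry_time A)).
  exact: measurable_stopped_payoff.
pose P := @game_law R N Omega eps0 eps alpha beta x0
  pI.1 (move_to sel) (min_time pI.2 (entry_time A)).
have ip : P.-integrable path (EFin \o payoff pI.2 (entry_time A)).
  apply: measurable_bounded_integrable => //.
  - exact: measurable_path.
  - apply: le_lt_trans (ltry 1); apply: probability_le1; exact: measurable_path.
  - exists C; split; first exact: num_real.
    by move=> M CM w pw; apply: le_trans (ltW CM); exact: payoff_le.
suff : ((v x0 - eta)%:E <=
    \int[P]_(w in path) (- payoff pI.2 (entry_time A) w)%:E)%E.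
  rewrite /v -opprD EFinN.
  under eq_integral do rewrite EFinN.
  rewrite integralN; first by rewrite leeN2.
  apply: integrable_add_def ip; exact: measurable_path.
apply: (play_bound muE mu_box N_gt0 bO Ox0 eps_range alpha01 betaE sI_ok sII_ok
  (min_stop pI_ok pII_ok) (min_exit pI_ok pII_ok) (C := C)) => //.
- exact: measurable_funN.
- by move=> w pw; rewrite normrN; exact: payoff_le.
- exact: ltW.
- move=> n w pw tw; rewrite /v lerN2.
  have [[cw ->]|[[Ow _ ->]|[Ow tn ->]]] := payoff_cases F Psi1 Psi2 Xx0 mX stI stII pw tw.
  + by rewrite u_collar.
  + exact: Psi1_le_u.
  + by have [[]//|[]] := entry_time_in tn.
move=> n h gh nh.
have [Oh nAh] := running_not_in pI_ok pII_ok (or_intror erefl) gh nh.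
set x := hlast h in Oh nAh *.
have ge_mean : mean_operator eps alpha beta u x <= u x.
  have : Num.max (Psi1 x) (Num.min (Psi2 x) (mean_operator eps alpha beta u x)) <= u x.
    by rewrite -u_eq.
  rewrite ge_max => /andP[_]; rewrite ge_min => /orP[le2|//].
  by exfalso; apply: nAh; right.
rewrite /v lerNl; apply: le_trans ge_mean.
have mB : measurable (eball x eps) by exact: measurable_eball.
have iu : mu.-integrable (eball x eps) (EFin \o u).
  have B_fin : (mu (eball x eps) < +oo)%E by rewrite (mu_eballE mu_box eps_gt0) ltry.
  apply: measurable_bounded_integrable => //.
    exact: measurable_funS mX (ball_X Oh) mu_.
  exists C; split; first exact: num_real.
  by move=> M CM y By; apply: le_trans (ltW CM); exact/uC/(ball_X Oh).
have -> : (\int[mu]_(y in eball x eps) (- u y)%:E =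
    - \int[mu]_(y in eball x eps) (u y)%:E)%E.
  under eq_integral do rewrite EFinN.
  by rewrite integralN//; exact: integrable_add_def iu.
rewrite /mean_operator -muE -/(volume mu eps x) fineN (mulrN (beta / volume mu eps x)).
set avg := beta / _ * _; set e := eta / 2 ^+ n.+1.
have Bx : (eball x eps) !=set0 by exists x; exact: eball_center.
have inf_ge : u (move_to sel h) - e <= inf (u @` eball x eps).
  apply: lb_le_inf; first by have [y By] := Bx; exists (u y), y.
  move=> _ [y By <-]; have [_ _ sel_max] := selP n.
  by have := sel_max x y Oh By; rewrite /v -/e -/(move_to sel h) /move_to; lra.
have sup_ge : u (pI.1 n h) <= sup (u @` eball x eps).
  apply: ub_le_sup; last by exists (pI.1 n h) => //; exact: ((sI_ok n).2 h gh.2).1.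
  exists C => _ [y By <-]; have := uC (ball_X Oh By).
  by rewrite ler_norml => /andP[].
have e0 : 0 <= e by rewrite divr_ge0 ?exprn_ge0// ltW.
have := ler_wpM2l half_alpha_ge0 inf_ge; have := ler_wpM2l half_alpha_ge0 sup_ge.
have := ler_wpM2r e0 half_alpha_le1; rewrite mul1r mulrBr.
by rewrite -/x; lra.
Qed.

(** The two guarantees bound the values by [u x0] on one side each; the inequality
    between the values holds in every game. *)
Lemma game_values : value_I Omega eps0 eps alpha beta F Psi1 Psi2 x0 = (u x0)%:E /\
  value_II Omega eps0 eps alpha beta F Psi1 Psi2 x0 = (u x0)%:E.
Proof.
set vI := value_I _ _ _ _ _ _ _ _ _; set vII := value_II _ _ _ _ _ _ _ _ _.
have u_le_vI : ((u x0)%:E <= vI)%E.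
  apply/lee_addgt0Pr => eta eta0; rewrite -leeBlDr// -EFinB.
  have [pI pI_ok ge_u] := playerI_guarantee eta0.
  apply: le_ereal_sup_tmp; exists (ereal_inf [set expected pI pII | pII in plays]).
    by exists pI.
  by apply: le_ereal_inf_tmp => _ [pII pII_ok <-]; exact: ge_u.
have vII_le_u : (vII <= (u x0)%:E)%E.
  apply/lee_addgt0Pr => eta eta0; rewrite -EFinD.
  have [pII pII_ok le_u] := playerII_guarantee eta0.
  apply: ge_ereal_inf; exists (ereal_sup [set expected pI pII | pI in plays]).
    by exists pII.
  by apply: ge_ereal_sup => _ [pI pI_ok <-]; exact: le_u.
have vI_le_vII : (vI <= vII)%E.
  apply: ge_ereal_sup => _ [pI pI_ok <-]; apply: le_ereal_inf_tmp => _ [pII pII_ok <-].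
  apply: (@le_trans _ _ (expected pI pII)).
    by apply: ereal_inf_lbound; exists pII.
  by apply: ereal_sup_ubound; exists pI.
split; apply/eqP; rewrite eq_le.
  by rewrite u_le_vI (le_trans vI_le_vII).
by rewrite vII_le_u (le_trans u_le_vI).
Qed.

End Value.

Theorem theorem5p4 (R : realType) (N : nat) (N_gt0 : (0 < N)%N)
  (Omega : set 'rV[R]_N) (Omega_dom : lipschitz_domain Omega)
  (eps0 : R) (eps0_small : 0 < eps0 < 1)
  (alpha beta : R) (alpha01 : 0 <= alpha < 1) (betaE : beta = 1 - alpha)
  (Psi1 Psi2 F : 'rV[R]_N -> R)
  (Psi1_borel : measurable_fun [set: 'rV[R]_N] Psi1)
  (Psi1_bounded : [bounded Psi1 x | x in [set: 'rV[R]_N]])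
  (Psi2_borel : measurable_fun [set: 'rV[R]_N] Psi2)
  (Psi2_bounded : [bounded Psi2 x | x in [set: 'rV[R]_N]])
  (F_borel : measurable_fun (collar Omega eps0) F)
  (F_bounded : [bounded F x | x in collar Omega eps0])
  (Psi12 : forall x, region Omega eps0 x -> Psi1 x <= Psi2 x)
  (Psi1F2 : forall x, collar Omega eps0 x -> Psi1 x <= F x <= Psi2 x)
  (eps : R) (eps_range : 0 < eps < eps0)
  (u : 'rV[R]_N -> R)
  (u_sol : obstacle_solution Omega eps0 eps alpha beta F Psi1 Psi2 u) :
  forall x0, Omega x0 ->
    value_I Omega eps0 eps alpha beta F Psi1 Psi2 x0 = (u x0)%:E /\
    value_II Omega eps0 eps alpha beta F Psi1 Psi2 x0 = (u x0)%:E.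
Proof.
move=> x0 Ox0; have [_ oO _ bO _] := Omega_dom.
have [mu muE mu_box] := @lebesgueN_box_measure R N.
have bound (A : set 'rV[R]_N) (f : 'rV[R]_N -> R) : [bounded f x | x in A] ->
    exists M : R, forall x, A x -> `|f x| <= M.
  by move=> [M [_ fM]]; exists (M + 1) => x; apply: fM; rewrite ltrDl.
have [M1 Psi1M] := bound _ _ Psi1_bounded.
have [M2 Psi2M] := bound _ _ Psi2_bounded.
have [MF FM] := bound _ _ F_bounded.
apply: (@game_values _ _ mu muE mu_box N_gt0 _ _ _ _ _ _ _ _ _ _
  (Num.max MF (Num.max M1 M2))) => //.
- by move=> x cx; rewrite le_max FM.
- by move=> x; rewrite !le_max Psi1M// orbT.
- by move=> x; rewrite !le_max Psi2M// !orbT.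
Qed.
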